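(* (Minimality theorem) Let $\mathbb K$ be a field, or more generally a graded field, and let $(V,m_V)$ be a $C_\infty$-algebra. Then there exists a minimal $C_\infty$-algebra $(U,m_U)$ and a weak equivalence of $C_\infty$-algebras $(U,m_U)\to(V,m_V)$.
   Context: $\mathbb K$ contains $\mathbb Q$ and is evenly graded; a graded field is a graded commutative ring whose nonzero homogeneous elements are invertible. Modules are graded, with $(\Sigma V)^i=V^{i+1}$; $\Sigma V^*$ means $\mathrm{Hom}_{\mathbb K}(\Sigma V,\mathbb K)$, a profinite module (inverse limit of free modules of finite rank). For $W$ profinite, $\widehat TW=\prod_{i\ge0}W^{\hat\otimes i}$ and $\widehat LW\subset\widehat TW$ is the Lie subalgebra of convergent (possibly infinite) linear combinations of Lie monomials. An endomorphism of $\widehat LW$ has order $n$ if it takes elements of tensor degree $i$ to elements of tensor degree $i+n-1$. A $C_\infty$-structure on a free graded module $V$ is a continuous derivation $m:\widehat L\Sigma V^*\to\widehat L\Sigma V^*$ of degree one with $m^2=0$; a $C_\infty$-algebra is a free graded module with a $C_\infty$-structure. Write $m=m_1+m_2+\cdots$ with $m_i$ of order $i$. The linear part $m_1$ is dual (up to suspension) to a differential $\check m_1:V\to V$. The $C_\infty$-algebra is minimal if $\check m_1=0$ (equivalently $m_1=0$). A $C_\infty$-morphism from $(U,m_U)$ to $(V,m_V)$ is a continuous Lie algebra homomorphism $\phi:\widehat L\Sigma V^*\to\widehat L\Sigma U^*$ of degree zero with $\phi\circ m_V=m_U\circ\phi$. Its linear part is dual (up to suspension) to a chain map $\check\phi_1:(U,(\check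 m_U)_1)\to(V,(\check m_V)_1)$; $\phi$ is a weak equivalence if $\check\phi_1$ is a quasi-isomorphism. *)

(* Defs.v *)
From HB Require Import structures.
From mathcomp Require Import all_boot all_order all_algebra finmap.
From mathcomp Require Import zify.
From mathcomp Require Import boolp classical_sets functions cardinality fsbigop.

Set Implicit Arguments.
Unset Strict Implicit.
Unset Printing Implicit Defensive.

Import GRing.Theory.
Local Open Scope ring_scope.

(* Everything is graded by int, internally: a graded object is its total module
   together with its homogeneous pieces, of which it is the direct sum. *)
Record grading (M : zmodType) := Grading {
  piece : int -> M -> Prop;
  piece0 : forall i, piece i 0;
  pieceB : forall i x y, piece i x -> piece i y -> piece i (x - y);
  piece_span : forall x, exists (s : seq int) (c : int -> M),
    (forall i, piece i (c i)) /\ x = \sum_(i <- s) c i;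
  piece_indep : forall (s : seq int) (c : int -> M),
    uniq s -> (forall i, piece i (c i)) -> \sum_(i <- s) c i = 0 ->
    forall i, i \in s -> c i = 0
}.

(* An evenly graded graded field containing Q.  As the odd pieces vanish, graded
   commutativity is plain commutativity of the total ring.  The total ring need
   not be a field: only its nonzero homogeneous elements are invertible. *)
Record gradedField := GradedField {
  gf_ring :> comUnitRingType;
  gf_grading : grading gf_ring;
  gf_one : piece gf_grading 0 1;
  gf_mul : forall i j x y, piece gf_grading i x -> piece gf_grading j y ->
    piece gf_grading (i + j) (x * y);
  gf_even : forall i x, odd `|i|%N -> piece gf_grading i x -> x = 0;
  gf_unit : forall i x, piece gf_grading i x -> x != 0 -> x \is a GRing.unit;
  gf_rat : inhabited {rmorphism rat -> gf_ring}
}.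

Record gmod (K : gradedField) := GMod {
  gm_mod :> lmodType K;
  gm_grading : grading gm_mod;
  gm_scale : forall i j (k : K) v, piece (gf_grading K) i k ->
    piece gm_grading j v -> piece gm_grading (i + j) (k *: v)
}.

Definition kdeg (K : gradedField) (i : int) (k : K) : Prop :=
  piece (gf_grading K) i k.

Definition gdeg (K : gradedField) (V : gmod K) (i : int) (v : V) : Prop :=
  piece (gm_grading V) i v.

(* Existence of a basis consisting of homogeneous vectors. *)
Definition gfree (K : gradedField) (V : gmod K) : Prop :=
  exists B : V -> Prop,
    [/\ (forall b, B b -> exists i, gdeg i b),
        (forall v, exists (s : seq V) (c : V -> K),
           (forall b, b \in s -> B b) /\ v = \sum_(b <- s) c b *: b) &
        (forall (s : seq V) (c : V -> K), uniq s -> (forall b, b \in s -> B b) ->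
           \sum_(b <- s) c b *: b = 0 -> forall b, b \in s -> c b = 0)].


Lemma shift_span (M : zmodType) (g : grading M) (x : M) :
  exists (s : seq int) (c : int -> M),
    (forall i, piece g (i + 1) (c i)) /\ x = \sum_(i <- s) c i.
Proof.
have [s [c [Hc ->]]] := piece_span g x.
exists (map (fun i => i - 1) s), (fun i => c (i + 1)); split=> //.
by rewrite big_map; apply: eq_bigr => i _; rewrite subrK.
Qed.

Lemma shift_indep (M : zmodType) (g : grading M) (s : seq int) (c : int -> M) :
  uniq s -> (forall i, piece g (i + 1) (c i)) -> \sum_(i <- s) c i = 0 ->
  forall i, i \in s -> c i = 0.
Proof.
move=> us Hc S0 i si; rewrite -(addrK 1 i).
apply: (piece_indep (g := g) (s := map (fun i => i + 1) s) (c := fun i => c (i - 1))).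
- by rewrite map_inj_uniq //; apply: addIr.
- by move=> j; rewrite -{1}(subrK 1 j).
- by rewrite big_map -[RHS]S0; apply: eq_bigr => j _; rewrite addrK.
- exact: map_f.
Qed.

Lemma shift_scale (K : gradedField) (V : gmod K) i j (k : K) (v : V) :
  kdeg i k -> gdeg (j + 1) v -> gdeg (i + j + 1) (k *: v).
Proof. by rewrite -addrA; apply: gm_scale. Qed.

(* (susp V)^i = V^(i+1), on the same total module. *)
Definition susp (K : gradedField) (V : gmod K) : gmod K :=
  @GMod K V
    (@Grading V (fun i => piece (gm_grading V) (i + 1))
       (fun i => piece0 (gm_grading V) (i + 1))
       (fun i => @pieceB _ (gm_grading V) (i + 1))
       (shift_span (gm_grading V)) (@shift_indep _ (gm_grading V)))
    (@shift_scale K V).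

(* The completed tensor algebra on P^* = Hom(P, K).

   The n-th completed tensor power of P^* is the inverse limit, over the free
   submodules F of P of finite rank, of the modules (F^* )^{(x) n}, that is, of
   the n-linear forms on F; so it consists of the n-linear forms on P, a tensor
   f_1 (x) ... (x) f_n being the form (x_1, ..., x_n) |-> f_1 x_1 * ... * f_n x_n.
   A family of n-linear forms, one for each n, is encoded as a function on words
   in P that is linear in each letter.  With this identification of tensors with
   forms, the product (concatenation of tensors) involves no sign.  No sign arises
   either when a scalar is moved past a vector, because K is even. *)
Definition wordfun (K : gradedField) (P : gmod K) : Type := seq P -> K^o.

Definition multilinear (K : gradedField) (P : gmod K) (f : wordfun P) : Prop :=
  forall (s t : seq P) (k : K) (x y : P),
    f (s ++ (k *: x + y) :: t) = k * f (s ++ x :: t) + f (s ++ y :: t).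

Definition word_deg (K : gradedField) (P : gmod K) (es : seq int) (w : seq P) : Prop :=
  size es = size w /\ forall i, (i < size w)%N -> gdeg (nth 0 es i) (nth 0 w i).

Definition form_deg (K : gradedField) (P : gmod K) (d : int) (f : wordfun P) : Prop :=
  forall es w, word_deg es w -> kdeg (d + \sum_(e <- es) e) (f w).

Definition tensor_degree (K : gradedField) (P : gmod K) (n : nat) (f : wordfun P) : Prop :=
  forall w, size w != n -> f w = 0.

Definition tmul (K : gradedField) (P : gmod K) (f g : wordfun P) : wordfun P :=
  fun w => \sum_(i < (size w).+1) f (take i w) * g (drop i w).

Definition ksign (K : gradedField) (i : int) : K := (-1) ^+ `|i|%N.

(* The graded commutator of f of degree i and g of degree j. *)
Definition tbracket (K : gradedField) (P : gmod K) (i j : int) (f g : wordfun P) : wordfun P :=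
  tmul f g - ksign K (i * j) *: tmul g f.

Inductive lie_monomial (K : gradedField) (P : gmod K) : int -> wordfun P -> Prop :=
| lie_gen d f : multilinear f -> tensor_degree 1 f -> form_deg d f ->
    lie_monomial d f
| lie_br i j f g : lie_monomial i f -> lie_monomial j g ->
    lie_monomial (i + j) (tbracket i j f g).

(* Degree d elements of the completed free Lie algebra: convergent sums of terms
   c a *: x a of degree d, where x a is a Lie monomial.  The topology on forms is
   that of pointwise convergence with K discrete (it is the inverse limit
   topology), so that a sum converges if and only if, on each word, all but
   finitely many of its terms vanish. *)
Definition lie_deg (K : gradedField) (P : gmod K) (d : int) (f : wordfun P) : Prop :=
  exists (I : choiceType) (c : I -> K) (e : I -> int) (x : I -> wordfun P),
    [/\ (forall a, lie_monomial (e a) (x a)),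
        (forall a, kdeg (d - e a) (c a)),
        (forall w, finite_set (fun a => c a * x a w != 0)) &
        (forall w, f w = \sum_(a \in [set: I]) c a * x a w)].

(* The underlying set of the completed free Lie algebra: finite sums of
   homogeneous elements. *)
Inductive lie_elt (K : gradedField) (P : gmod K) : wordfun P -> Prop :=
| lie_elt0 : lie_elt 0
| lie_eltD d f g : lie_deg d f -> lie_elt g -> lie_elt (f + g).

Definition lie_pred (K : gradedField) (P : gmod K) : {pred wordfun P} :=
  fun f => `[< lie_elt f >].

Lemma lie_degZ (K : gradedField) (P : gmod K) i d (k : K) (f : wordfun P) :
  kdeg i k -> lie_deg d f -> lie_deg (i + d) (k *: f).
Proof.
move=> hk [I [c [e [x [hx hc hfin hf]]]]].
exists I, (fun a => k * c a), e, x; split=> //.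
- by move=> a; rewrite -addrA; exact: gf_mul hk (hc a).
- move=> w; apply: sub_finite_set (hfin w) => a /=.
  by apply: contra => /eqP h; rewrite -mulrA h mulr0.
- move=> w; have -> : (k *: f) w = k * f w by [].
  have [A hA] := finite_fsetP.1 (hfin w).
  have zA a : a \notin A -> c a * x a w = 0.
    move=> aA; apply/eqP; apply: contraNT aA => h.
    by have : [set` A]%classic a by rewrite -hA.
  rewrite hf (fsbigTE A) // (fsbigTE A); last first.
    by move=> a /zA h; rewrite -mulrA h mulr0.
  by rewrite mulr_sumr; apply: eq_bigr => a _; rewrite mulrA.
Qed.

Lemma lie_elt_add (K : gradedField) (P : gmod K) (f g : wordfun P) :
  lie_elt f -> lie_elt g -> lie_elt (f + g).
Proof.
elim=> [|d f1 f2 h1 _ IH] hg; first by rewrite add0r.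
by rewrite -addrA; apply: lie_eltD h1 (IH hg).
Qed.

Lemma lie_elt_deg (K : gradedField) (P : gmod K) d (f : wordfun P) :
  lie_deg d f -> lie_elt f.
Proof. by move=> h; rewrite -[f]addr0; apply: lie_eltD h (lie_elt0 _). Qed.

Lemma lie_elt_scale (K : gradedField) (P : gmod K) (k : K) (f : wordfun P) :
  lie_elt f -> lie_elt (k *: f).
Proof.
elim=> [|d f1 f2 h1 _ IH]; first by rewrite scaler0; apply: lie_elt0.
rewrite scalerDr; apply: lie_elt_add => //.
have [s [c [hc ->]]] := piece_span (gf_grading K) k.
rewrite scaler_suml; elim: s => [|i s IHs]; first by rewrite big_nil; apply: lie_elt0.
by rewrite big_cons; apply: lie_eltD IHs; apply: lie_degZ h1; apply: hc.
Qed.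

Lemma lie_submod_closed (K : gradedField) (P : gmod K) : submod_closed (@lie_pred K P).
Proof.
split; first by apply/asboolP; apply: lie_elt0.
move=> k f g /asboolP hf /asboolP hg; apply/asboolP.
by apply: lie_elt_add => //; apply: lie_elt_scale.
Qed.

HB.instance Definition _ (K : gradedField) (P : gmod K) :=
  GRing.isSubmodClosed.Build K (wordfun P) (@lie_pred K P) (@lie_submod_closed K P).

(* The completed free Lie algebra on P^*, as a K-module. *)
Record freeLie (K : gradedField) (P : gmod K) := FreeLie {
  flval :> wordfun P;
  flvalP : flval \in @lie_pred K P
}.

HB.instance Definition _ (K : gradedField) (P : gmod K) :=
  [isSub for @flval K P].
HB.instance Definition _ (K : gradedField) (P : gmod K) :=
  [Choice of freeLie P by <:].
HB.instance Definition _ (K : gradedField) (P : gmod K) :=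
  [SubChoice_isSubLmodule of freeLie P by <:].

Definition fldeg (K : gradedField) (P : gmod K) (d : int) (f : freeLie P) : Prop :=
  lie_deg d (flval f).

Lemma ksign_even (K : gradedField) (i j : int) (k : K) :
  kdeg (i - j) k -> forall n, ksign K (i * n) * k = ksign K (j * n) * k.
Proof.
move=> hk n; case: (boolP (odd `|i - j|)) => [h|].
  by rewrite (gf_even h hk) !mulr0.
move=> h; congr (_ * _); rewrite /ksign -[LHS]signr_odd -[RHS]signr_odd !abszM !oddM.
suff -> : odd `|i| = odd `|j| by [].
have -> : i = (i - j) + j by rewrite subrK.
move: (i - j) h => l; case: l => l; case: j {hk} => j; rewrite ?NegzE /=; lia.
Qed.

Lemma conv_seq (K : gradedField) (P : gmod K) (I : choiceType)
    (x : I -> wordfun P) (f : wordfun P) :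
  (forall w, finite_set (fun a => x a w != 0)) ->
  (forall w, f w = \sum_(a \in [set: I]) x a w) ->
  forall W : seq (seq P), exists r : seq I, uniq r /\ forall u, u \in W ->
    (forall a, a \notin r -> x a u = 0) /\ f u = \sum_(a <- r) x a u.
Proof.
move=> hfin hf W.
have [r hr] : exists r : seq I, forall u, u \in W -> forall a, a \notin r -> x a u = 0.
  elim: W => [|u W [r hr]]; first by exists [::].
  have [A hA] := finite_fsetP.1 (hfin u).
  exists (enum_fset A ++ r) => v; rewrite inE => /orP[/eqP->|vW] a;
    rewrite mem_cat negb_or => /andP[aA ar]; last exact: hr.
  apply/eqP; apply: contraNT aA => h.
  by have : [set` A]%classic a by rewrite -hA.
exists (undup r); split=> [|u uW]; first exact: undup_uniq.
have z a : a \notin undup r -> x a u = 0 by rewrite mem_undup; apply: hr.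
split=> //; rewrite hf (fsbigE (undup r)) ?undup_uniq //; last by move=> a _; apply: z.
by apply: eq_bigl => a; rewrite in_setT.
Qed.

Lemma lie_deg_bracket (K : gradedField) (P : gmod K) i j (f g : wordfun P) :
  lie_deg i f -> lie_deg j g -> lie_deg (i + j) (tbracket i j f g).
Proof.
move=> [I [c [e [x [hx hc hfin hf]]]]] [J [c' [e' [y [hy hc' hfin' hg]]]]].
pose X a : wordfun P := fun w => c a * x a w.
pose Y b : wordfun P := fun w => c' b * y b w.
pose C (p : I * J) := c p.1 * c' p.2.
pose Z (p : I * J) : wordfun P := tbracket (e p.1) (e' p.2) (x p.1) (y p.2).
have sgn p : C p * ksign K (e p.1 * e' p.2) = C p * ksign K (i * j).
  transitivity (C p * ksign K (i * e' p.2)).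
    rewrite /C mulrAC [RHS]mulrAC; congr (_ * _).
    by rewrite mulrC [RHS]mulrC; apply/esym/ksign_even/hc.
  rewrite /C -[LHS]mulrA -[RHS]mulrA; congr (_ * _).
  by rewrite mulrC [RHS]mulrC ![i * _]mulrC; apply/esym/ksign_even/hc'.
have term p w : C p * Z p w =
    tmul (X p.1) (Y p.2) w - ksign K (i * j) * tmul (Y p.2) (X p.1) w.
  have -> : Z p w = tmul (x p.1) (y p.2) w
      - ksign K (e p.1 * e' p.2) * tmul (y p.2) (x p.1) w by [].
  have -> : tmul (X p.1) (Y p.2) w = C p * tmul (x p.1) (y p.2) w.
    by rewrite /tmul mulr_sumr; apply: eq_bigr => k _; rewrite [RHS]mulrACA.
  have -> : tmul (Y p.2) (X p.1) w = C p * tmul (y p.2) (x p.1) w.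
    by rewrite /tmul mulr_sumr; apply: eq_bigr => k _; rewrite /C [c _ * _]mulrC [RHS]mulrACA.
  rewrite mulrBr; congr (_ - _).
  by rewrite [LHS](@mulrA K) [RHS](@mulrCA K) [RHS](@mulrA K); congr (_ * _); apply: sgn.
pose W (w : seq P) := [seq take k w | k <- iota 0 (size w).+1] ++
                      [seq drop k w | k <- iota 0 (size w).+1].
have Wt w (k : 'I_(size w).+1) : take k w \in W w.
  by rewrite mem_cat; apply/orP; left; apply/mapP; exists (k : nat); rewrite ?mem_iota /=.
have Wd w (k : 'I_(size w).+1) : drop k w \in W w.
  by rewrite mem_cat; apply/orP; right; apply/mapP; exists (k : nat); rewrite ?mem_iota /=.
have key w : exists r : seq (I * J), [/\ uniq r,
    (forall p, p \notin r -> C p * Z p w = 0) &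
    tbracket i j f g w = \sum_(p <- r) C p * Z p w].
  have [r [ur hr]] := @conv_seq K P I X f hfin hf (W w).
  have [r' [ur' hr']] := @conv_seq K P J Y g hfin' hg (W w).
  exists [seq (a, b) | a <- r, b <- r']; split.
  - by apply: allpairs_uniq => // -[? ?] [? ?].
  - move=> [a b] hab; rewrite term /tmul /= !big1 ?mulr0 ?subr0 // => k _.
      have [ar|ar] := boolP (a \in r); last first.
        by rewrite (hr _ (Wd w k)).1 // mulr0.
      have [br|br] := boolP (b \in r'); last first.
        by rewrite (hr' _ (Wt w k)).1 // mul0r.
      by move: hab; rewrite allpairs_f.
    have [ar|ar] := boolP (a \in r); last first.
      by rewrite (hr _ (Wt w k)).1 // mul0r.
    have [br|br] := boolP (b \in r'); last first.
      by rewrite (hr' _ (Wd w k)).1 // mulr0.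
    by move: hab; rewrite allpairs_f.
  - have -> : tbracket i j f g w = tmul f g w - ksign K (i * j) * tmul g f w by [].
    under eq_bigr do rewrite term.
    rewrite sumrB -mulr_sumr !big_allpairs /=; congr (_ - _ * _); rewrite /tmul.
      under [RHS]eq_bigr do rewrite exchange_big /=.
      rewrite [RHS]exchange_big /=; apply: eq_bigr => k _.
      by rewrite (hr _ (Wt w k)).2 (hr' _ (Wd w k)).2 big_distrlr.
    under [RHS]eq_bigr do rewrite exchange_big /=.
    rewrite [RHS]exchange_big /=; apply: eq_bigr => k _.
    by rewrite (hr _ (Wd w k)).2 (hr' _ (Wt w k)).2 big_distrlr exchange_big.
exists (I * J)%type, C, (fun p => e p.1 + e' p.2), Z; split.
- by move=> p; apply: lie_br.
- move=> p; have := gf_mul (hc p.1) (hc' p.2); rewrite /kdeg.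
  by have -> : i - e p.1 + (j - e' p.2) = i + j - (e p.1 + e' p.2) by lia.
- move=> w; have [r [ur hr _]] := key w.
  apply: (sub_finite_set (B := [set` r]%classic)); last exact: finite_seq.
  by move=> p /=; apply: contraNT => /hr ->.
- move=> w; have [r [ur hr ->]] := key w.
  rewrite (fsbigE r) //; last by move=> p _; apply: hr.
  by apply: eq_bigl => p; rewrite in_setT.
Qed.

Lemma flbracket_subproof (K : gradedField) (P : gmod K) i j (f g : freeLie P) :
  fldeg i f -> fldeg j g -> tbracket i j f g \in @lie_pred K P.
Proof. by move=> hf hg; apply/asboolP; apply: lie_elt_deg (lie_deg_bracket hf hg). Qed.

Definition flbracket (K : gradedField) (P : gmod K) i j (f g : freeLie P)
    (hf : fldeg i f) (hg : fldeg j g) : freeLie P :=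
  FreeLie (flbracket_subproof hf hg).

(* Continuity of a linear map; the open neighbourhoods of 0 are generated by the
   sets of the forms vanishing on a given word. *)
Definition fl_continuous (K : gradedField) (P Q : gmod K)
    (phi : {linear freeLie P -> freeLie Q}) : Prop :=
  forall w : seq Q, exists S : seq (seq P), forall f : freeLie P,
    (forall s, s \in S -> flval f s = 0) -> flval (phi f) w = 0.

Record cinf_structure (K : gradedField) (V : gmod K) := CInfStructure {
  ci_map :> {linear freeLie (susp V) -> freeLie (susp V)};
  ci_cont : fl_continuous ci_map;
  ci_deg : forall d f, fldeg d f -> fldeg (d + 1) (ci_map f);
  ci_der : forall i j f g (hf : fldeg i f) (hg : fldeg j g),
    ci_map (flbracket hf hg) =
      flbracket (ci_deg hf) hg + ksign K i *: flbracket hf (ci_deg hg);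
  ci_sq : forall f, ci_map (ci_map f) = 0
}.

Record cinf_algebra (K : gradedField) := CInfAlgebra {
  ca_mod :> gmod K;
  ca_free : gfree ca_mod;
  ca_diff : cinf_structure ca_mod
}.

(* A morphism U -> V is a map of Lie algebras in the opposite direction. *)
Record cinf_morphism (K : gradedField) (U V : cinf_algebra K) := CInfMorphism {
  cm_map :> {linear freeLie (susp V) -> freeLie (susp U)};
  cm_cont : fl_continuous cm_map;
  cm_deg : forall d f, fldeg d f -> fldeg d (cm_map f);
  cm_bracket : forall i j f g (hf : fldeg i f) (hg : fldeg j g),
    cm_map (flbracket hf hg) = flbracket (cm_deg hf) (cm_deg hg);
  cm_comm : forall f, cm_map (ca_diff V f) = ca_diff U (cm_map f)
}.

(* The linear part of phi, which sends f of tensor degree 1 to the component of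
   tensor degree 1 of phi f, is dual to F, up to suspension.  When V is free, F is
   determined by phi.  No Koszul sign is put in the dual: such a sign depends only
   on degrees, and changes neither kernels nor images. *)
Definition linear_part_dual (K : gradedField) (U V : gmod K)
    (phi : {linear freeLie (susp V) -> freeLie (susp U)})
    (F : {linear U -> V}) : Prop :=
  forall f : freeLie (susp V), tensor_degree 1 (flval f) ->
    forall u : U, flval (phi f) [:: u : susp U] = flval f [:: F u : susp V].

Definition cinf_minimal (K : gradedField) (V : cinf_algebra K) : Prop :=
  exists D : {linear V -> V},
    linear_part_dual (ca_diff V) D /\ forall v, D v = 0.

(* F is a chain map (U, dU) -> (V, dV) inducing an injection and a surjection
   ker dU / im dU -> ker dV / im dV. *)
Definition quasi_iso (K : gradedField) (U V : gmod K)
    (dU : {linear U -> U}) (dV : {linear V -> V}) (F : {linear U -> V}) : Prop :=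
  [/\ (forall u, F (dU u) = dV (F u)),
      (forall u, dU u = 0 -> (exists v, F u = dV v) -> exists u', u = dU u') &
      (forall v, dV v = 0 -> exists u, dU u = 0 /\ exists v', v = F u + dV v')].

Definition weak_equivalence (K : gradedField) (U V : cinf_algebra K)
    (phi : cinf_morphism U V) : Prop :=
  exists (dU : {linear U -> U}) (dV : {linear V -> V}) (F : {linear U -> V}),
    [/\ linear_part_dual (ca_diff U) dU, linear_part_dual (ca_diff V) dV,
        linear_part_dual phi F & quasi_iso dU dV F].

(* Main.v *)
(* Let P = susp V, let d be the map dual to the linear part of m, and let h be a contraction,
   so that V = H + im (d h) + im (h d) with H = ker d and ker h intersected.  The linear forms
   on P split accordingly as W_H + A + B, where m_1 maps A = {f = f d h} isomorphically onto B.
   As m f = m_1 f + higher order terms, there is an automorphism Psi of the completed free Lie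
   algebra which is the identity on W_H and on A and sends m_1 f to m f for f in A.  For the
   conjugate derivation m' = Psi^-1 m Psi we have m' = m_1 on A and m' = 0 on B, so the kernel
   of the projection Pi that kills A and B is stable under m'.  Hence m' descends to the
   completed free Lie algebra on W_H, where it has no linear part, and Pi Psi^-1 is a weak
   equivalence, as its linear part is dual to the inclusion of H.

   That Psi and its inverse preserve convergent sums of Lie monomials rests on the fact that
   these sums form a closed set. *)

Require Import Defs.
From HB Require Import structures.
From mathcomp Require Import all_boot all_order all_algebra finmap.
From mathcomp Require Import zify.
From mathcomp Require Import boolp classical_sets functions cardinality fsbigop.

Set Implicit Arguments.
Unset Strict Implicit.
Unset Printing Implicit Defensive.

Import GRing.Theory.
Local Open Scope ring_scope.

(** [lie_deg] asks for a single convergent sum that serves all words, while the image of such a sum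
    under a substitution, or under the inverse of one, is at first known only through finite
    approximations that change with the finite set of words considered. Hence the notion
    [lie_closure], stable under limits, and the proof that it coincides with [lie_deg].

    Homomorphisms are handled through their transposes: [f] goes to the form whose value at [w] is
    the sum of the [f u] over a finite list of words [u]. Dually, continuity makes a map restricted
    to linear forms an evaluation at vectors [M w] of [P] itself, so that no bidual enters. On
    linear forms [Psi f] is [f (id - h d) + m (f h)]; its transpose cuts a word into blocks and
    applies [h M] to each block of at least two letters. The summand [- f h d] cancels the linear
    part of [m (f h)], so [Psi] differs from the identity only by terms on strictly shorter words
    and is inverted by recursion on length.

    Since only homogeneous scalars are invertible, bases are built by comparing homogeneous
    components of relations. *)

Lemma big_undup_count (M : zmodType) (I : eqType) (s : seq I) (F : I -> M) :
  \sum_(i <- s) F i = \sum_(i <- undup s) F i *+ count_mem i s.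
Proof. exact: esym (big_undup_iterop_count _ s xpredT F). Qed.

Lemma big_supp_widen (M : zmodType) (I : eqType) (s t : seq I) (F : I -> M) :
  uniq s -> uniq t -> {subset s <= t} -> (forall i, i \notin s -> F i = 0) ->
  \sum_(i <- s) F i = \sum_(i <- t) F i.
Proof.
move=> us ut st z; rewrite [RHS](bigID (mem s)) /= [X in _ = _ + X]big1 //.
rewrite addr0 -[RHS]big_filter; apply: perm_big; apply: uniq_perm => //.
  exact: filter_uniq.
by move=> i; rewrite mem_filter; case: (boolP (i \in s)) => // /st ->.
Qed.

(** * Graded linear algebra *)

Section Components.
Variables (M : zmodType) (g : grading M).

Definition is_decomp (x : M) (p : seq int * (int -> M)) :=
  [/\ uniq p.1, (forall i, piece g i (p.2 i)),
      (forall i, i \notin p.1 -> p.2 i = 0) & x = \sum_(i <- p.1) p.2 i].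

Lemma pieceD i x y : piece g i x -> piece g i y -> piece g i (x + y).
Proof.
move=> hx hy; rewrite -[y]opprK; apply: pieceB => //.
by rewrite -[- y]add0r; apply: pieceB => //; apply: piece0.
Qed.

Lemma piece_sum i (I : Type) (s : seq I) (F : I -> M) :
  (forall a, piece g i (F a)) -> piece g i (\sum_(a <- s) F a).
Proof.
move=> h; elim: s => [|a s IH]; first by rewrite big_nil; apply: piece0.
by rewrite big_cons; apply: pieceD.
Qed.

Lemma pieceMn i x n : piece g i x -> piece g i (x *+ n).
Proof.
move=> h; elim: n => [|n IH]; first by rewrite mulr0n; apply: piece0.
by rewrite mulrS; apply: pieceD.
Qed.

Lemma decomp_ex x : exists p, is_decomp x p.
Proof.
have [s [c [hc ->]]] := piece_span g x.
exists (undup s, fun i => c i *+ count_mem i s); split=> /=.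
- exact: undup_uniq.
- by move=> i; apply: pieceMn.
- by move=> i; rewrite mem_undup => /count_memPn ->.
- exact: big_undup_count.
Qed.

Lemma decomp_uniq x p q : is_decomp x p -> is_decomp x q -> p.2 =1 q.2.
Proof.
case: p q => [s c] [t d] [/= us hc zc ->] [/= ut hd zd e] i.
pose r := undup (s ++ t).
have ur : uniq r by apply: undup_uniq.
have sr : {subset s <= r} by move=> j js; rewrite mem_undup mem_cat js.
have tr : {subset t <= r} by move=> j js; rewrite mem_undup mem_cat js orbT.
have S0 : \sum_(j <- r) (c j - d j) = 0.
  by rewrite sumrB -(big_supp_widen us ur sr zc) -(big_supp_widen ut ur tr zd) e subrr.
apply/eqP; rewrite -subr_eq0; apply/eqP.
have [ir|ir] := boolP (i \in r).
  apply: (piece_indep (g := g) ur) S0 i ir => j; exact: pieceB.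
by rewrite zc ?zd ?subrr //; apply: contra ir => h; [apply: tr|apply: sr].
Qed.

Definition gcomp (i : int) (x : M) : M := (projT1 (cid (decomp_ex x))).2 i.

Lemma gcompE x p : is_decomp x p -> forall i, gcomp i x = p.2 i.
Proof. by move=> h; apply: decomp_uniq h; apply: projT2 (cid _). Qed.

Lemma gcompP i x : piece g i (gcomp i x).
Proof. by rewrite /gcomp; case: cid => p []. Qed.

Lemma gcomp_sum x : exists s, uniq s /\ x = \sum_(i <- s) gcomp i x.
Proof.
have [p hp] := decomp_ex x; have [us _ _ h] := hp; exists p.1; split=> //.
by rewrite {1}h; apply: eq_bigr => i _; rewrite (gcompE hp).
Qed.

Lemma gcomp_piece i x : piece g i x -> forall j, gcomp j x = if j == i then x else 0.
Proof.
move=> h; apply: (gcompE (p := ([:: i], fun j => if j == i then x else 0))).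
split=> //= [j|j|]; last by rewrite big_seq1 eqxx.
- by case: eqP => [->|_] //; apply: piece0.
- by rewrite inE => /negbTE ->.
Qed.

Lemma gcompD i x y : gcomp i (x + y) = gcomp i x + gcomp i y.
Proof.
have [p hp] := decomp_ex x; have [q hq] := decomp_ex y.
pose r := undup (p.1 ++ q.1).
have ur : uniq r by apply: undup_uniq.
have pr : {subset p.1 <= r} by move=> j js; rewrite mem_undup mem_cat js.
have qr : {subset q.1 <= r} by move=> j js; rewrite mem_undup mem_cat js orbT.
rewrite (gcompE hp) (gcompE hq).
apply: (gcompE (p := (r, fun i => p.2 i + q.2 i))).
case: hp hq => up hp zp ep [uq hq zq eq]; split=> //= [j|j|].
- exact: pieceD.
- by move=> jr; rewrite zp ?zq ?addr0 //; apply: contra jr => h; [apply: qr|apply: pr].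
- by rewrite big_split /= -(big_supp_widen up ur pr zp) -(big_supp_widen uq ur qr zq) -ep -eq.
Qed.

Lemma gcomp0 i : gcomp i 0 = 0.
Proof. by rewrite (gcomp_piece (piece0 g 0)) if_same. Qed.

Lemma gcomp_big i (I : Type) (s : seq I) (F : I -> M) :
  gcomp i (\sum_(a <- s) F a) = \sum_(a <- s) gcomp i (F a).
Proof.
elim: s => [|a s IH]; first by rewrite !big_nil gcomp0.
by rewrite !big_cons gcompD IH.
Qed.

End Components.

(** * Bases and coordinates over a graded field *)

Section HomogeneousBases.
Variables (K : gradedField) (V : gmod K).
Implicit Types (X T B : set V) (s : seq V) (c : V -> K).

(** Used to project a linear relation among homogeneous vectors to one degree, where its
    coefficients become homogeneous, hence zero or invertible. *)
Lemma gcompZ i j (k : K) (v : V) : gdeg j v ->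
  gcomp (gm_grading V) i (k *: v) = gcomp (gf_grading K) (i - j) k *: v.
Proof.
move=> hv; have [s [us e]] := gcomp_sum (gf_grading K) k.
have [hi|hi] := boolP ((i - j) \in s); last first.
  have z : gcomp (gf_grading K) (i - j) k = 0.
    rewrite e gcomp_big big_seq big1 // => l ls.
    rewrite (gcomp_piece (gcompP _ l k)); case: eqP => // h.
    by rewrite h ls in hi.
  rewrite z scale0r {1}e scaler_suml gcomp_big big_seq big1 // => l ls.
  rewrite (gcomp_piece (gm_scale (gcompP _ l k) hv)); case: eqP => // h.
  by rewrite h addrK ls in hi.
rewrite {1}e scaler_suml gcomp_big (bigD1_seq (i - j)) //= big1 ?addr0.
  by rewrite (gcomp_piece (gm_scale (gcompP _ _ k) hv)) subrK eqxx.
move=> l li; rewrite (gcomp_piece (gm_scale (gcompP _ l k) hv)); case: eqP => // h.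
by rewrite h addrK eqxx in li.
Qed.

Definition indep X := forall s c, uniq s -> (forall b, b \in s -> X b) ->
  \sum_(b <- s) c b *: b = 0 -> forall b, b \in s -> c b = 0.

Definition spanned X (v : V) := exists s c,
  (forall b, b \in s -> X b) /\ v = \sum_(b <- s) c b *: b.

Definition homogeneous X := forall b, X b -> exists i, gdeg i b.

Definition is_coord X (v : V) (p : seq V * (V -> K)) :=
  [/\ uniq p.1, (forall b, b \in p.1 -> X b),
      (forall b, b \notin p.1 -> p.2 b = 0) & v = \sum_(b <- p.1) p.2 b *: b].

Lemma spanned_coord X v : spanned X v -> exists p, is_coord X v p.
Proof.
move=> [s [c [hs ->]]]; exists (undup s, fun b => c b *+ count_mem b s); split=> /=.
- exact: undup_uniq.
- by move=> b; rewrite mem_undup; apply: hs.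
- by move=> b; rewrite mem_undup => /count_memPn ->.
- by rewrite big_undup_count; apply: eq_bigr => b _; rewrite scalerMnl.
Qed.

Lemma coord_widen s (t : seq V) c (M : lmodType K) (G : V -> M) :
  uniq s -> uniq t -> {subset s <= t} -> (forall b, b \notin s -> c b = 0) ->
  \sum_(b <- s) c b *: G b = \sum_(b <- t) c b *: G b.
Proof.
by move=> us ut st z; apply: big_supp_widen => // b /z ->; rewrite scale0r.
Qed.

Lemma is_coordP X k v w p q : is_coord X v p -> is_coord X w q ->
  is_coord X (k *: v + w) (undup (p.1 ++ q.1), fun b => k * p.2 b + q.2 b).
Proof.
move=> [up hp zp ep] [uq hq zq eq].
have ur : uniq (undup (p.1 ++ q.1)) by apply: undup_uniq.
split=> //=.
- by move=> b; rewrite mem_undup mem_cat => /orP[/hp|/hq].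
- by move=> b; rewrite mem_undup mem_cat negb_or => /andP[/zp -> /zq ->]; rewrite mulr0 addr0.
- under eq_bigr do rewrite scalerDl -scalerA.
  rewrite big_split /= -scaler_sumr.
  rewrite -(coord_widen id up ur _ zp) ?(coord_widen id uq ur _ zq) -?ep -?eq //.
    by rewrite -(coord_widen id uq ur _ zq) -?eq // => b; rewrite mem_undup mem_cat => ->; rewrite orbT.
  by move=> b; rewrite mem_undup mem_cat => ->.
Qed.

Lemma is_coord_uniq X v p q : indep X -> is_coord X v p -> is_coord X v q -> p.2 =1 q.2.
Proof.
move=> iX hp hq b.
have [/= ur hr zr e0] := is_coordP (- 1) hp hq.
have [br|br] := boolP (b \in undup (p.1 ++ q.1)); last first.
  have [[_ _ zp _] [_ _ zq _]] := (hp, hq).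
  by move: br; rewrite mem_undup mem_cat negb_or => /andP[/zp -> /zq ->].
rewrite scaleN1r addNr in e0.
by move/esym: e0 => /(iX _ _ ur hr) /(_ b br); rewrite mulN1r addrC => /eqP; rewrite subr_eq0 => /eqP.
Qed.

(** Zorn's lemma for the subsets [X] of [T] whose union with [X0] is independent. [T] need not be a
    submodule: the set of all homogeneous vectors yields a basis of the module, and the set of
    values of a differential at homogeneous vectors yields a homogeneous basis of its image. *)
Lemma extend_indep T X0 : homogeneous T -> indep X0 -> (X0 `<=` T)%classic ->
  exists X, [/\ (X0 `<=` X)%classic, (X `<=` T)%classic, indep X &
    forall t, T t -> spanned X t].
Proof.
move=> hT i0 s0.
have [F hF tF|A [[iA sA] mA]] :=
  @Zorn_bigcup V (fun X => indep (X0 `|` X)%classic /\ (X `<=` T)%classic).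
  split; last by move=> b [X XF] Xb; have [_ h] := hF _ XF; apply: h.
  move=> s c us hs.
  (* A finite list meets finitely many members of the chain, and the largest of these contains all
     that is not in [X0]. A list inside [X0] is treated apart, as the chain may be empty. *)
  have [X [hX hXs]] : exists X, indep X /\ forall b, b \in s -> X b.
    have {}hs : forall b, b \in s -> X0 b \/ exists2 X, F X & X b.
      by move=> b /hs [|[X]]; [left|right; exists X].
    suff [h|[X XF h]] : (forall b, b \in s -> X0 b) \/
        exists2 X, F X & forall b, b \in s -> (X0 `|` X)%classic b.
    - by exists X0.
    - by exists (X0 `|` X)%classic; split=> //; have [] := hF _ XF.
    elim: s hs {us} => [|a s IH] hs; first by left.
    have hs' b : b \in s -> X0 b \/ exists2 X, F X & X b.
      by move=> bs; apply: hs; rewrite inE bs orbT.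
    have [ha|[X XF Xa]] := hs a (mem_head _ _); case: (IH hs') => [h|[Y YF h]].
    - by left=> b; rewrite inE => /orP[/eqP ->|/h].
    - by right; exists Y => // b; rewrite inE => /orP[/eqP ->|/h] //; left.
    - by right; exists X => // b; rewrite inE => /orP[/eqP ->|/h]; [right|left].
    - right; case: (tF _ _ XF YF) => sub.
        exists Y => // b; rewrite inE => /orP[/eqP ->|/h] //.
        by right; apply: sub.
      exists X => // b; rewrite inE => /orP[/eqP ->|/h]; first by right.
      by case=> [|/sub]; [left|right].
  exact: hX.
exists (X0 `|` A)%classic; split=> //; first by move=> b [/s0|/sA].
move=> t Tt; apply: contrapT => nt.
apply: (mA (A `|` [set t])%classic).
  split; last first.
    move=> sub; apply: nt; exists [:: t], (fun=> 1).
    split; last by rewrite big_seq1 scale1r.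
    by move=> b; rewrite inE => /eqP ->; right; apply: sub; right.
  by move=> b Ab; left.
split; last by move=> b [/sA|->].
have {}mA : forall s c, uniq s -> (forall b, b \in s -> (X0 `|` A)%classic b) ->
    forall k, k *: t + \sum_(b <- s) c b *: b = 0 -> k = 0.
  move=> s c us hs k e0; apply: contrapT => k0; apply: nt.
  (* k need not be invertible, but a nonzero homogeneous component of it is. *)
  have [j kj] : exists j, gcomp (gf_grading K) j k != 0.
    apply: contrapT => h; apply: k0.
    have [r [_ ->]] := gcomp_sum (gf_grading K) k; rewrite big1 // => j _.
    by apply/eqP; apply: contrapT => /negP h'; apply: h; exists j.
  have [i hi] := hT _ Tt.
  have deg b : exists i, b \in s -> gdeg i b.
    have [/hs h|_] := boolP (b \in s); last by exists 0.
    by case: h => [/s0|/sA] /hT [l hl]; exists l.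
  pose dg b := projT1 (cid (deg b)).
  have dgP b : b \in s -> gdeg (dg b) b by apply: projT2 (cid (deg b)).
  have := congr1 (gcomp (gm_grading V) (j + i)) e0.
  rewrite gcompD gcomp0 (gcompZ _ _ hi) addrK gcomp_big big_seq.
  under eq_bigr => b bs do rewrite (gcompZ _ _ (dgP b bs)).
  rewrite -big_seq; set kk := gcomp _ j k in kj *.
  have ku : kk \is a GRing.unit by apply: gf_unit (gcompP _ j k) kj.
  move=> /eqP; rewrite addr_eq0 => /eqP e.
  exists s, (fun b => - (kk^-1 * gcomp (gf_grading K) (j + i - dg b) (c b))); split=> //.
  rewrite -[t]scale1r -(mulVr ku) -scalerA e scalerN scaler_sumr -sumrN.
  by apply: eq_bigr => b _; rewrite scaleNr scalerA.
move=> s c us hs e0.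
have hs' b : b \in s -> b != t -> (X0 `|` A)%classic b.
  by move=> /hs [|[|/= ->]]; [left|right|rewrite eqxx].
have [ts|ts] := boolP (t \in s); last first.
  apply: iA => // b bs; apply: hs' => //; by apply: contraNneq ts => <-.
have hr b : b \in rem t s -> (X0 `|` A)%classic b.
  by rewrite mem_rem_uniq // inE => /andP[bt bs]; apply: hs'.
rewrite (big_rem _ ts) /= in e0.
have ct : c t = 0 by apply: mA e0 => //; apply: rem_uniq.
rewrite ct scale0r add0r in e0.
move=> b bs; have [->//|bt] := eqVneq b t.
by apply: (iA _ _ (rem_uniq t us) hr e0); rewrite mem_rem_uniq // inE bt.
Qed.

Definition gbasis B := [/\ homogeneous B, indep B & forall v, spanned B v].

Lemma extend_gbasis X0 : homogeneous X0 -> indep X0 ->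
  exists B, (X0 `<=` B)%classic /\ gbasis B.
Proof.
move=> h0 i0.
have [||X [h1 h2 h3 h4]] := @extend_indep (fun v => exists i, gdeg i v) X0 _ i0 => //.
exists X; split=> //; split=> // v.
have [s [_ ->]] := gcomp_sum (gm_grading V) v.
suff sp j : spanned X (gcomp (gm_grading V) j v).
  elim: s => [|j s IH].
    by exists [::], (fun=> 0); split=> //; rewrite !big_nil.
  have [p hp] := spanned_coord (sp j); have [q hq] := spanned_coord IH.
  have [_ hr _ e] := is_coordP 1 hp hq.
  by rewrite big_cons -[gcomp _ j v]scale1r e; eexists; eexists; split=> //; apply: hr.
by apply: h4; exists j; apply: gcompP.
Qed.

Lemma gbasis_ex : exists B, gbasis B.
Proof.
have [||B []] := @extend_gbasis set0 => //; last by exists B.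
by move=> s c _ hs _ b /hs.
Qed.

(** Provides the freeness of the module that underlies the minimal model. *)
Lemma gmod_gfree : gfree V.
Proof. by have [B [hB iB sB]] := gbasis_ex; exists B. Qed.

Section Coordinates.
Variables (B : set V) (hB : gbasis B).

Lemma coord_ex v : exists p, is_coord B v p.
Proof. by case: hB => _ _ sB; apply: spanned_coord. Qed.

Definition csupp v : seq V := (projT1 (cid (coord_ex v))).1.
Definition coord v (b : V) : K := (projT1 (cid (coord_ex v))).2 b.

Lemma coordP v : is_coord B v (csupp v, coord v).
Proof. by rewrite /csupp /coord; case: cid => -[]. Qed.

Lemma csuppB v b : b \in csupp v -> B b.
Proof. by have [_ h _ _] := coordP v; apply: h. Qed.

Lemma coord_out v b : b \notin csupp v -> coord v b = 0.
Proof. by have [_ _ h _] := coordP v; apply: h. Qed.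

Lemma coordE v p : is_coord B v p -> forall b, coord v b = p.2 b.
Proof. by case: hB => _ iB _ h; apply: is_coord_uniq iB (coordP v) h. Qed.

Lemma coordZD k v w b : coord (k *: v + w) b = k * coord v b + coord w b.
Proof. exact: coordE (is_coordP k (coordP v) (coordP w)) b. Qed.

Lemma coord_basis a b : B a -> coord a b = (b == a)%:R.
Proof.
move=> Ba; apply: (coordE (p := ([:: a], fun b => (b == a)%:R))); split=> //=.
- by move=> c; rewrite inE => /eqP ->.
- by move=> c; rewrite inE => /negbTE ->.
- by rewrite big_seq1 eqxx scale1r.
Qed.

Lemma coord_sum v (t : seq V) : uniq t -> {subset csupp v <= t} ->
  v = \sum_(b <- t) coord v b *: b.
Proof.
have [us _ z e] := coordP v => ut st.
by rewrite -(coord_widen id us ut st z).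
Qed.

Lemma coord_inj v w : coord v =1 coord w -> v = w.
Proof.
move=> h; pose t := undup (csupp v ++ csupp w).
have ut : uniq t by apply: undup_uniq.
have tv : {subset csupp v <= t} by move=> b; rewrite mem_undup mem_cat => ->.
have tw : {subset csupp w <= t} by move=> b; rewrite mem_undup mem_cat orbC => ->.
by rewrite (coord_sum ut tv) [RHS](coord_sum ut tw); apply: eq_bigr => b _; rewrite h.
Qed.

Lemma bdeg_ex b : exists i, B b -> gdeg i b.
Proof.
have [hh _ _] := hB.
by have [/hh [l]|nb] := pselect (B b); [exists l|exists 0].
Qed.

Definition bdeg b : int := projT1 (cid (bdeg_ex b)).

Lemma bdegP b : B b -> gdeg (bdeg b) b.
Proof. exact: projT2 (cid (bdeg_ex b)). Qed.

(** Replacing each coordinate by its component of the expected degree still represents [v]; by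
    uniqueness of coordinates nothing has changed. *)
Lemma coord_deg i v b : gdeg i v -> kdeg (i - bdeg b) (coord v b).
Proof.
move=> hv; have [us hs zs e] := coordP v.
rewrite (@coordE v (csupp v, fun b => gcomp (gf_grading K) (i - bdeg b) (coord v b))) /=.
  exact: gcompP.
split=> //= [a /zs /= ->|]; first by rewrite gcomp0.
have := gcomp_piece hv i; rewrite eqxx => h; rewrite -{1}h {1}e gcomp_big /= big_seq.
by rewrite [RHS]big_seq; apply: eq_bigr => a /hs /bdegP ha; apply: gcompZ.
Qed.

Section Extension.
Variables (M : lmodType K) (G : V -> M).

Definition lin_ext v : M := \sum_(b <- csupp v) coord v b *: G b.

Lemma lin_extE t v : uniq t -> {subset csupp v <= t} ->
  lin_ext v = \sum_(b <- t) coord v b *: G b.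
Proof. by have [us _ z _] := coordP v => ut st; apply: coord_widen. Qed.

Lemma lin_ext_linear : linear lin_ext.
Proof.
move=> k v w; pose t := undup (csupp v ++ csupp w ++ csupp (k *: v + w)).
have ut : uniq t by apply: undup_uniq.
rewrite !(@lin_extE t) //; try by move=> b; rewrite mem_undup !mem_cat => ->; rewrite ?orbT.
rewrite scaler_sumr -big_split; apply: eq_bigr => b _.
by rewrite coordZD scalerDl scalerA.
Qed.

Lemma lin_ext_basis b : B b -> lin_ext b = G b.
Proof.
move=> Bb; pose t := undup (b :: csupp b).
have ut : uniq t by apply: undup_uniq.
have bt : b \in t by rewrite mem_undup mem_head.
rewrite (@lin_extE t) //; last by move=> a; rewrite mem_undup inE => ->; rewrite orbT.
rewrite (bigD1_seq b) //= coord_basis // eqxx scale1r big1 ?addr0 // => a ab.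
by rewrite coord_basis // (negbTE ab) scale0r.
Qed.

End Extension.

HB.instance Definition _ (M : lmodType K) (G : V -> M) :=
  GRing.isLinear.Build K V M *:%R (lin_ext G) (lin_ext_linear G).

Lemma lin_ext_deg (V' : gmod K) (G : V -> V') n :
  (forall b, B b -> gdeg (bdeg b + n) (G b)) ->
  forall i v, gdeg i v -> gdeg (i + n) (lin_ext G v).
Proof.
move=> hG i v hv; rewrite /lin_ext big_seq.
suff h b : b \in csupp v -> gdeg (i + n) (coord v b *: G b).
  elim: (csupp v) h => [|b s IH] h; first by rewrite -big_seq big_nil; apply: piece0.
  rewrite -big_seq big_cons; apply: pieceD; first by apply: h; rewrite mem_head.
  by rewrite big_seq; apply: IH => a as_; apply: h; rewrite inE as_ orbT.
move=> /csuppB /hG; have := coord_deg b hv => hc hb.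
by have := gm_scale hc hb; rewrite addrA subrK.
Qed.

End Coordinates.
End HomogeneousBases.

(** * The completed free Lie algebra is closed *)

Section Words.
Variables (K : gradedField) (P : gmod K).
Implicit Types (f g x y : wordfun P) (w u : seq P).

Lemma tmul_nil f g : tmul f g [::] = f [::] * g [::].
Proof. by rewrite /tmul big_ord_recl big_ord0 addr0. Qed.

Lemma tmul_cons f g v w :
  tmul f g (v :: w) = f [::] * g (v :: w) + tmul (fun u => f (v :: u)) g w.
Proof. by rewrite /tmul big_ord_recl. Qed.

Lemma tmulDl f1 f2 g w : tmul (f1 + f2) g w = tmul f1 g w + tmul f2 g w.
Proof. by rewrite /tmul -big_split; apply: eq_bigr => i _; exact: mulrDl. Qed.

Lemma tbracketE i j f g w :
  tbracket i j f g w = tmul f g w - ksign K (i * j) * tmul g f w.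
Proof. by []. Qed.

Lemma tmul_sum (I J : Type) (r : seq I) (s : seq J) (F : I -> wordfun P)
    (G : J -> wordfun P) f g w :
  (forall i, f (take i w) = \sum_(a <- r) F a (take i w)) ->
  (forall i, g (drop i w) = \sum_(b <- s) G b (drop i w)) ->
  tmul f g w = \sum_(a <- r) \sum_(b <- s) tmul (F a) (G b) w.
Proof.
move=> hf hg; under [RHS]eq_bigr do rewrite exchange_big /=.
by rewrite [RHS]exchange_big /=; apply: eq_bigr => i _; rewrite hf hg big_distrlr.
Qed.

Lemma multilinear_cons f v : multilinear f -> multilinear (fun w => f (v :: w)).
Proof. by move=> hf s t; apply: (hf (v :: s)). Qed.

Lemma tmul_multilinear f g : multilinear f -> multilinear g -> multilinear (tmul f g).
Proof.
move=> hf hg s; elim: s f hf => [|z s IH] f hf t k x y.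
  rewrite !cat0s !tmul_cons mulrDr addrACA; congr (_ + _).
    by rewrite (hg [::]) mulrDr !(mulrCA k).
  rewrite /tmul mulr_sumr -big_split; apply: eq_bigr => i _.
  by rewrite (hf [::]) mulrDl mulrA.
rewrite !cat_cons !tmul_cons (IH _ (multilinear_cons z hf)) mulrDr addrACA.
by congr (_ + _); rewrite (hg (z :: s)) mulrDr !(mulrCA k).
Qed.

Lemma ksign_deg0 i : kdeg 0 (ksign K i).
Proof.
have h1 : kdeg 0 (- 1 : K).
  by rewrite -[- 1]add0r; apply: pieceB; [apply: piece0|apply: gf_one].
rewrite /ksign; elim: `|i|%N => [|n IH]; first exact: gf_one.
by rewrite exprS -(addr0 0); apply: gf_mul.
Qed.

Lemma word_deg_take i es w : word_deg es w -> word_deg (take i es) (take i w).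
Proof.
move=> [hs h]; split; first by rewrite !size_take hs.
move=> j; rewrite size_take => hj.
have [ji jw] : (j < i)%N /\ (j < size w)%N by move: hj; case: ifP; lia.
by rewrite !nth_take //; apply: h.
Qed.

Lemma word_deg_drop i es w : word_deg es w -> word_deg (drop i es) (drop i w).
Proof.
move=> [hs h]; split; first by rewrite !size_drop hs.
by move=> j; rewrite size_drop !nth_drop => hj; apply: h; lia.
Qed.

Lemma tmul_deg i j f g : form_deg i f -> form_deg j g -> form_deg (i + j) (tmul f g).
Proof.
move=> hf hg es w hw; apply: piece_sum => l.
rewrite -{1}(cat_take_drop l es) big_cat /= addrACA.
by apply: gf_mul; [apply/hf/word_deg_take|apply/hg/word_deg_drop].
Qed.

Lemma tmul_tensor m n f g : tensor_degree m f -> tensor_degree n g ->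
  tensor_degree (m + n) (tmul f g).
Proof.
move=> hf hg w hw; apply: big1 => i _.
have [hi|hi] := eqVneq (size (take i w)) m; last by rewrite hf ?mul0r.
rewrite hg ?mulr0 // size_drop; apply: contra hw => /eqP hd.
by apply/eqP; move: hi; rewrite size_takel; have := ltn_ord i; lia.
Qed.

Lemma tbracket_multilinear i j f g :
  multilinear f -> multilinear g -> multilinear (tbracket i j f g).
Proof.
move=> hf hg s t k x y; rewrite !tbracketE !tmul_multilinear // !mulrDr opprD addrACA.
by rewrite mulrN (mulrCA k).
Qed.

Lemma tbracket_deg i j f g : form_deg i f -> form_deg j g ->
  form_deg (i + j) (tbracket i j f g).
Proof.
move=> hf hg es w hw; rewrite tbracketE; apply: pieceB; first exact: tmul_deg.
by rewrite -[i + j + _]add0r (addrC i); apply: gf_mul (ksign_deg0 _) _; apply: tmul_deg.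
Qed.

Lemma tbracket_tensor i j m n f g : tensor_degree m f -> tensor_degree n g ->
  tensor_degree (m + n) (tbracket i j f g).
Proof.
move=> hf hg w hw; rewrite tbracketE (tmul_tensor hf hg) // (tmul_tensor hg hf) ?mulr0 ?subr0 //.
by rewrite addnC.
Qed.

Lemma tbracket_eq0 i j f g w :
  (forall l, f (take l w) * g (drop l w) = 0) ->
  (forall l, g (take l w) * f (drop l w) = 0) -> tbracket i j f g w = 0.
Proof.
by move=> h1 h2; rewrite tbracketE /tmul !big1 ?mulr0 ?subr0.
Qed.

Lemma tbracket_sum i j (I J : Type) (r : seq I) (s : seq J) (F : I -> wordfun P)
    (G : J -> wordfun P) f g w :
  (forall l, f (take l w) = \sum_(a <- r) F a (take l w)) ->
  (forall l, f (drop l w) = \sum_(a <- r) F a (drop l w)) ->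
  (forall l, g (take l w) = \sum_(b <- s) G b (take l w)) ->
  (forall l, g (drop l w) = \sum_(b <- s) G b (drop l w)) ->
  tbracket i j f g w = \sum_(a <- r) \sum_(b <- s) tbracket i j (F a) (G b) w.
Proof.
move=> f1 f2 g1 g2; rewrite tbracketE (tmul_sum f1 g2) (tmul_sum g1 f2).
rewrite [X in _ * X]exchange_big mulr_sumr -sumrB; apply: eq_bigr => a _.
by rewrite mulr_sumr -sumrB.
Qed.

Lemma monomial_multilinear d x : lie_monomial d x -> multilinear x.
Proof. by elim=> // i j f g _ hf _ hg; apply: tbracket_multilinear. Qed.

Lemma monomial_deg d x : lie_monomial d x -> form_deg d x.
Proof. by elim=> // i j f g _ hf _ hg; apply: tbracket_deg. Qed.

Lemma monomial_tensor d x : lie_monomial d x -> exists n, (0 < n)%N /\ tensor_degree n x.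
Proof.
elim=> [e f _ h _|i j f g _ [m [m0 hm]] _ [n [n0 hn]]]; first by exists 1%N.
by exists (m + n)%N; split; [rewrite addn_gt0 m0|apply: tbracket_tensor].
Qed.

Lemma monomial0 : lie_monomial 0 (0 : wordfun P).
Proof.
by apply: lie_gen => // [s t k x y|es w _]; [rewrite mulr0 addr0|apply: piece0].
Qed.

Record lterm (d : int) := LTerm {
  tc : K; te : int; tx : wordfun P;
  tdeg : kdeg (d - te) tc;
  tmon : lie_monomial te tx
}.

Definition lterm0 d : lterm d := LTerm (piece0 _ (d - 0)) monomial0.

Definition tval d (L : seq (lterm d)) : wordfun P := fun w => \sum_(t <- L) tc t * tx t w.

(** The closure of the finite sums of terms of degree [d] for pointwise convergence. The
    approximating sum may depend on [W], whereas in [lie_deg] one family serves all words. *)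
Definition lie_closure d f := forall W : seq (seq P), exists L : seq (lterm d),
  forall w, w \in W -> f w = tval L w.

Lemma tval_cat d (L M : seq (lterm d)) w : tval (L ++ M) w = tval L w + tval M w.
Proof. exact: big_cat. Qed.

Lemma lie_deg_closure d f : lie_deg d f -> lie_closure d f.
Proof.
move=> [I [c [e [x [hx hc hfin hf]]]]] W.
have [r [_ hr]] := @conv_seq K P I (fun a w => c a * x a w) f hfin hf W.
exists [seq LTerm (hc a) (hx a) | a <- r] => w /hr [_ ->].
by rewrite /tval big_map.
Qed.

Lemma lie_closure_limit d f :
  (forall W : seq (seq P), exists2 g, lie_closure d g & forall w, w \in W -> f w = g w) ->
  lie_closure d f.
Proof.
move=> h W; have [g hg e] := h W; have [L hL] := hg W.
by exists L => w wW; rewrite e ?hL.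
Qed.

Lemma lie_closure_multilinear d f : lie_closure d f -> multilinear f.
Proof.
move=> h s t k x y.
have [L hL] := h [:: s ++ (k *: x + y) :: t; s ++ x :: t; s ++ y :: t].
rewrite !hL ?inE ?eqxx ?orbT // /tval mulr_sumr -big_split; apply: eq_bigr => a _.
by rewrite (monomial_multilinear (tmon a)) mulrDr mulrCA.
Qed.

Lemma lie_closure_deg d f : lie_closure d f -> form_deg d f.
Proof.
move=> h es w hw; have [L ->] := h [:: w]; last by rewrite inE.
apply: piece_sum => t; have := gf_mul (tdeg t) (monomial_deg (tmon t) hw).
by rewrite addrA subrK.
Qed.

Lemma lie_closure_nil d f : lie_closure d f -> f [::] = 0.
Proof.
move=> h; have [L ->] := h [:: [::]]; last by rewrite inE.
apply: big1 => t _; have [n [n0 ->]] := monomial_tensor (tmon t); first by rewrite mulr0.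
by rewrite eq_sym -lt0n.
Qed.

Lemma lie_closureD d f g : lie_closure d f -> lie_closure d g -> lie_closure d (f + g).
Proof.
move=> hf hg W; have [L hL] := hf W; have [M hM] := hg W.
by exists (L ++ M) => w wW; rewrite tval_cat -hL // -hM.
Qed.

Lemma monomial_closure d x : lie_monomial d x -> lie_closure d x.
Proof.
move=> hx W; have h1 : kdeg (d - d) (1 : K) by rewrite subrr; apply: gf_one.
by exists [:: LTerm h1 hx] => w _; rewrite /tval big_seq1 mul1r.
Qed.

(** * Closedness of the set of convergent Lie sums *)

Section Closed.
Variables (B : set P) (hB : gbasis B).

Lemma multilinear_ext f g : multilinear f -> multilinear g ->
  (forall w, (forall v, v \in w -> B v) -> f w = g w) -> f =1 g.
Proof.
move=> hf hg hfg w; rewrite -[w]cat0s.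
(* The induction replaces letters from left to right: the generalized prefix [s] consists of letters
   that are already basis vectors. *)
have : forall v, v \in ([::] : seq P) -> B v by [].
elim: w [::] => [|v w IH] s hs; first by rewrite cats0; apply: hfg.
have [_ hv _ ->] := coordP hB v; move: (csupp hB v) hv => r /= hr.
have sum0 h : multilinear h ->
    h (s ++ \sum_(b <- r) coord hB v b *: b :: w) =
    \sum_(b <- r) coord hB v b * h (s ++ b :: w).
  move=> hh; elim: (r) => [|b r' IHr].
    rewrite !big_nil; have := hh s w 1 0 0; rewrite scale1r addr0 mul1r.
    by move/esym/eqP; rewrite -subr_eq0 addrK => /eqP.
  by rewrite !big_cons hh IHr.
rewrite !sum0 // big_seq [RHS]big_seq; apply: eq_bigr => b br.
rewrite -!cat_rcons IH // => a; rewrite mem_rcons inE => /orP[/eqP ->|/hs //].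
exact: hr.
Qed.

(* For x nonzero on a word w and pure on F, every b in F is a coordinate of some letter of
   w; so only finitely many F admit pure forms that do not vanish on w. *)
Definition pure (F : {fset P}) x :=
  (forall b w, b \in F -> (forall v, v \in w -> coord hB v b = 0) -> x w = 0) /\
  (forall w v, (forall a, a \in w -> B a) -> v \in w -> v \notin F -> x w = 0).

Record pmono (d : int) := PMono {
  pF : {fset P}; px : wordfun P; pmon : lie_monomial d px; ppure : pure pF px }.

Definition coord_form (b : P) (k : K) : wordfun P :=
  fun w => if w is [:: v] then k * coord hB v b else 0.

Lemma coord_form_gen d b k : kdeg (d + bdeg hB b) k -> lie_monomial d (coord_form b k).
Proof.
move=> hk; apply: lie_gen.
- move=> [|a [|a' s]] [|b' t] l x y; rewrite /coord_form /= ?mulr0 ?addr0 //.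
  by rewrite coordZD mulrDr mulrCA.
- by move=> [|a [|a' s]].
- move=> es [|v [|v' w]] [hs h]; rewrite /coord_form; try exact: piece0.
  case: es hs h => [|e [|e' es]] // _ /(_ 0%N isT) /= h.
  have := gf_mul hk (coord_deg hB b h); rewrite big_seq1 /kdeg.
  by have -> : d + bdeg hB b + (e - bdeg hB b) = d + e by lia.
Qed.

Lemma coord_form_pure b k : B b -> pure [fset b]%fset (coord_form b k).
Proof.
move=> Bb; split=> [a|] [|v [|v' w]] //=.
  by rewrite inE => /eqP -> h; rewrite h ?mulr0 // mem_head.
move=> a /(_ v (mem_head _ _)) Bv; rewrite !inE => /eqP -> vb.
by rewrite coord_basis // eq_sym (negbTE vb) mulr0.
Qed.

Lemma tbracket_pure i j (F G : {fset P}) f g : pure F f -> pure G g ->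
  pure (F `|` G)%fset (tbracket i j f g).
Proof.
move=> [f1 f2] [g1 g2]; split=> [b w|w v hw vw].
  have st l : {subset take l w <= w} by move=> ? /mem_take.
  have sd l : {subset drop l w <= w} by move=> ? /mem_drop.
  rewrite inE => /orP[bF|bG] hw; apply: tbracket_eq0 => l.
  - by rewrite (f1 b) ?mul0r // => v /st; apply: hw.
  - by rewrite (f1 b) ?mulr0 // => v /sd; apply: hw.
  - by rewrite (g1 b) ?mulr0 // => v /sd; apply: hw.
  - by rewrite (g1 b) ?mul0r // => v /st; apply: hw.
rewrite inE negb_or => /andP[vF vG].
have st l a : a \in take l w -> B a by move/mem_take; apply: hw.
have sd l a : a \in drop l w -> B a by move/mem_drop; apply: hw.
have tv l : v \in take l w \/ v \in drop l w.
  by apply/orP; rewrite -mem_cat cat_take_drop.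
apply: tbracket_eq0 => l; case: (tv l) => h.
- by rewrite (f2 _ v (st l)) ?mul0r.
- by rewrite (g2 _ v (sd l)) ?mulr0.
- by rewrite (g2 _ v (st l)) ?mul0r.
- by rewrite (f2 _ v (sd l)) ?mulr0.
Qed.

(** On words in a finite set [F] of basis vectors, each linear form at a leaf of the monomial agrees
    with a combination of the coordinates at the elements of [F], and brackets distribute over these
    sums. *)
Lemma monomial_pure d x : lie_monomial d x -> forall F : seq P,
  uniq F -> (forall b, b \in F -> B b) -> exists L : seq (pmono d),
  forall w, (forall v, v \in w -> v \in F) -> x w = \sum_(t <- L) px t w.
Proof.
elim=> {d x} [d f mf tf df|i j f g _ IHf _ IHg] F uF hF; last first.
  have [L hL] := IHf F uF hF; have [M hM] := IHg F uF hF.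
  pose br (s : pmono i) (t : pmono j) :=
    PMono (lie_br (pmon s) (pmon t)) (tbracket_pure i j (ppure s) (ppure t)).
  exists [seq br s t | s <- L, t <- M] => w hw.
  have st l v : v \in take l w -> v \in F by move/mem_take; apply: hw.
  have sd l v : v \in drop l w -> v \in F by move/mem_drop; apply: hw.
  by rewrite big_allpairs_dep; apply: tbracket_sum => l;
    [apply/hL/st|apply/hL/sd|apply/hM/st|apply/hM/sd].
have [L hL] : exists L : seq (pmono d), forall w,
    \sum_(t <- L) px t w = \sum_(b <- F) coord_form b (f [:: b]) w.
  elim: F hF {uF} => [|b F IH] hF; first by exists [::] => w; rewrite !big_nil.
  have [L hL] := IH (fun a aF => hF a (mem_behead (s := b :: F) aF)).
  have Bb : B b by apply: hF; rewrite mem_head.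
  have fb : kdeg (d + bdeg hB b) (f [:: b]).
    have := df [:: bdeg hB b] [:: b]; rewrite big_seq1; apply; split=> //.
    by case=> // _; apply: bdegP.
  exists (PMono (coord_form_gen fb) (coord_form_pure _ Bb) :: L) => w.
  by rewrite !big_cons hL.
exists L => -[|v [|v' w]] hw; rewrite hL; try by rewrite tf // big1.
have vF : v \in F by apply: hw; rewrite mem_head.
rewrite (bigD1_seq v) //= coord_basis ?eqxx ?mulr1; last exact: hF.
by rewrite big1 ?addr0 // => b bv; rewrite coord_basis ?(negbTE bv) ?mulr0 //; apply: hF.
Qed.

(** On a word of basis vectors, the two halves of purity give the two inclusions between [F] and the
    set of letters whenever the form does not vanish. *)
Lemma pure_ne n (F G : {fset P}) d x w : lie_monomial d x -> pure F x -> size w = n ->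
  (forall v, v \in w -> B v) -> w =i G -> F != G \/ ~ tensor_degree n x -> x w = 0.
Proof.
move=> hx [p1 p2] hn hw wG; case=> [FG|nt].
  have [/fsubsetP FsG|/fsubsetPn[b bF bG]] := boolP (F `<=` G)%fset; last first.
    apply: (p1 b) => // v vw; rewrite coord_basis; last exact: hw.
    by have [bv|//] := eqVneq b v; move: bG; rewrite -wG bv vw.
  have [v vG vF] : exists2 v, v \in G & v \notin F.
    apply/fsubsetPn; apply: contra FG => GF; rewrite eqEfsubset GF andbT.
    exact/fsubsetP.
  by apply: (p2 w v) => //; rewrite wG.
have [m [_ hm]] := monomial_tensor hx; apply: (hm).
by apply/eqP => mn; apply: nt; rewrite -hn mn.
Qed.

Fixpoint words (n : nat) (F : seq P) : seq (seq P) :=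
  if n is n'.+1 then [seq b :: w | b <- F, w <- words n' F] else [:: [::]].

Lemma mem_words n F w : size w = n -> (forall v, v \in w -> v \in F) -> w \in words n F.
Proof.
elim: n w => [|n IH] [|v w] //= [hn] hw; apply/allpairsP; exists (v, w); split=> //=.
  by apply: hw; rewrite mem_head.
by apply: IH => // a aw; apply: hw; rewrite inE aw orbT.
Qed.

(** The index [i] is unbounded: past the end of the list [nth] returns [lterm0], whose form is zero
    and thus pure on every set. This lets the lists be merged below into one family indexed by
    triples. *)
Definition pure_list d n (F : {fset P}) (L : seq (lterm d)) := forall i,
  pure F (tx (nth (lterm0 d) L i)) /\ tensor_degree n (tx (nth (lterm0 d) L i)).

Lemma closure_pure d f n (F : {fset P}) : lie_closure d f ->
  exists L : seq (lterm d), pure_list n F L /\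
    forall w, size w = n -> (forall v, v \in w -> B v) -> w =i F -> f w = tval L w.
Proof.
move=> hf.
have p0 : pure_list n F ([::] : seq (lterm d)) by move=> i; rewrite nth_nil.
(* If [F] has an element outside [B], no word of basis vectors has [F] as its set of letters, and
   the empty list will do. *)
have [FB|nFB] := pselect (forall b, b \in F -> B b); last first.
  by exists [::]; split=> // w _ hw wF; case: nFB => b; rewrite -wF; apply: hw.
have [L0 hL0] := hf (words n (enum_fset F)).
have [L [pL hL]] : exists L : seq (lterm d), pure_list n F L /\
    forall w, size w = n -> (forall v, v \in w -> B v) -> w =i F -> tval L0 w = tval L w.
  elim: L0 {hL0} => [|t L0 [L [pL hL]]]; first by exists [::].
  have [M hM] := monomial_pure (tmon t) (fset_uniq F) FB.
  have [N [pN hN]] : exists N : seq (lterm d), pure_list n F N /\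
    forall w, size w = n -> (forall v, v \in w -> B v) -> w =i F ->
      \sum_(s <- M) tc t * px s w = tval N w.
    elim: M {hM} => [|s M [N [pN hN]]].
      by exists [::]; split=> // w *; rewrite /tval !big_nil.
    have [[sF sn]|ns] := pselect (pF s = F /\ tensor_degree n (px s)).
      exists (LTerm (tdeg t) (pmon s) :: N); split.
        by case=> //=; split=> //; rewrite -{1}sF; apply: ppure.
      by move=> w *; rewrite /tval !big_cons hN.
    exists N; split=> // w hn wB wF; rewrite big_cons hN //.
    rewrite (pure_ne (pmon s) (ppure s) hn wB wF) ?mulr0 ?add0r //.
    have [sF|?] := eqVneq (pF s) F; last by left.
    by right=> sn; apply: ns.
  exists (N ++ L); split.
    by move=> i; rewrite nth_cat; case: ifP.
  move=> w hn wB wF; rewrite tval_cat -hN // -hL // /tval big_cons; congr (_ + _).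
  by rewrite hM ?mulr_sumr // => v; rewrite wF.
exists L; split=> // w hn wB wF; rewrite -hL // hL0 // mem_words // => v.
by rewrite wF.
Qed.

(* The approximations of f on larger and larger sets of words are not coherent, so they
   cannot be summed directly.  Instead, for each tensor degree n and each finite set F of
   basis vectors, one approximation on the finitely many words of length n in F is expanded
   into pure monomials, of which only those pure on F are kept. *)
Lemma lie_closed d f : lie_closure d f -> lie_deg d f.
Proof.
move=> hf.
pose L n F := projT1 (cid (@closure_pure d f n F hf)).
have pL n F : pure_list n F (L n F).
  exact: (projT2 (cid (@closure_pure d f n F hf))).1.
have hL n (F : {fset P}) w : size w = n -> (forall v, v \in w -> B v) -> w =i F -> f w = tval (L n F) w.
  exact: (projT2 (cid (@closure_pure d f n F hf))).2.
pose T (a : nat * {fset P} * nat) := nth (lterm0 d) (L a.1.1 a.1.2) a.2.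
have Tout n F i : (size (L n F) <= i)%N -> T (n, F, i) = lterm0 d by apply: nth_default.
(* Local finiteness: a term that is nonzero on [w] has the length of [w] as its first index, a
   subset of the basis vectors occurring in the letters of [w] as its second, and a third index
   within the list. *)
pose S w := [fset b | b in flatten [seq csupp hB v | v <- w]]%fset.
pose R w := [seq (size w, F, i) | F <- enum_fset (fpowerset (S w)), i <- iota 0 (size (L (size w) F))].
have TR w a : tc (T a) * tx (T a) w != 0 -> a \in R w.
  case: a => [[n F] i] nz.
  have [[p1 p2] tn] := pL n F i.
  have wn : size w = n.
    by apply/eqP; apply: contraNT nz => /tn h; rewrite h mulr0.
  have iL : (i < size (L n F))%N.
    by rewrite ltnNge; apply: contra nz => /Tout ->; rewrite mul0r.
  have iw : i \in iota 0 (size (L (size w) F)) by rewrite wn mem_iota.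
  apply/allpairsPdep; exists F, i; split=> //; last by rewrite wn.
  rewrite fpowersetE; apply/fsubsetP => b bF; rewrite !inE /=.
  apply: contraNT nz => bS; rewrite /T /= (p1 b w bF) ?mulr0 // => v vw.
  apply: coord_out; apply: contra bS => bv.
  by apply/flattenP; exists (csupp hB v) => //; apply: map_f.
have fin w : finite_set (fun a => tc (T a) * tx (T a) w != 0).
  apply: (sub_finite_set (B := [set` R w]%classic)); last exact: finite_seq.
  by move=> a /= /TR.
pose g : wordfun P := fun w => \sum_(a \in [set: (nat * {fset P} * nat)%type]) tc (T a) * tx (T a) w.
exists (nat * {fset P} * nat)%type, (fun a => tc (T a)), (fun a => te (T a)), (fun a => tx (T a)).
split=> // [a|a|]; first exact: tmon.
  exact: tdeg.
suff : f =1 g by [].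
apply: multilinear_ext; first exact: lie_closure_multilinear hf.
  move=> s t k x y.
  have [r [_ hr]] := @conv_seq K P _ (fun a w => tc (T a) * tx (T a) w) g fin
    (fun=> erefl) [:: s ++ (k *: x + y) :: t; s ++ x :: t; s ++ y :: t].
  have e u : u \in [:: s ++ (k *: x + y) :: t; s ++ x :: t; s ++ y :: t] ->
    g u = \sum_(a <- r) tc (T a) * tx (T a) u by case/hr.
  rewrite !e ?inE ?eqxx ?orbT // mulr_sumr -big_split; apply: eq_bigr => a _.
  by rewrite (monomial_multilinear (tmon (T a))) mulrDr mulrCA.
(* On a word of basis vectors only the block indexed by its length and its set of letters
   contributes, and that block was chosen to agree with [f] there. *)
move=> w wB; pose F := [fset b | b in w]%fset.
have wF : w =i F by move=> b; rewrite !inE.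
rewrite (hL (size w) F w) // /g (fsbigE [seq (size w, F, i) | i <- iota 0 (size (L (size w) F))]).
- rewrite /tval -{1}(mkseq_nth (lterm0 d) (L _ _)) big_map big_map.
  by apply: eq_big => i; rewrite ?in_setT.
- by rewrite map_inj_uniq ?iota_uniq // => i j [].
- by [].
- move=> [[n G] i] _ ni; apply/eqP; apply: contraNT ni => nz.
  have en : size w = n.
    by apply/eqP; apply: contraNT nz => /(pL n G i).2 h; rewrite h mulr0.
  have eG : G = F.
    apply/eqP; apply: contraNT nz => GF.
    by rewrite (pure_ne (tmon _) (pL n G i).1 en wB wF) ?mulr0 //; left.
  rewrite en -eG; apply/mapP; exists i => //; rewrite mem_iota /= ltnNge.
  by apply: contra nz => /Tout ->; rewrite mul0r.
Qed.

End Closed.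
End Words.

(** * Homomorphisms given by substitution of words *)

Section FreeLie.
Variables (K : gradedField) (P : gmod K).
Implicit Types (f g : wordfun P).

Lemma wordfun_eq f g : f =1 g -> f = g.
Proof. exact: functional_extensionality_dep. Qed.

Lemma lie_closed_deg d f : lie_closure d f <-> lie_deg d f.
Proof.
split; last exact: lie_deg_closure.
by have [B hB] := gbasis_ex P => h; apply: (lie_closed hB h).
Qed.

Lemma lie_closure_bracket i j f g : lie_closure i f -> lie_closure j g ->
  lie_closure (i + j) (tbracket i j f g).
Proof. by rewrite !lie_closed_deg; apply: lie_deg_bracket. Qed.

Lemma lie_closureZ d e k f : kdeg (d - e) k -> lie_closure e f -> lie_closure d (k *: f).
Proof.
rewrite !lie_closed_deg => hk hf; have := lie_degZ hk hf.
by rewrite subrK.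
Qed.

Lemma lie_closure0 d : lie_closure d (0 : wordfun P).
Proof. by move=> W; exists [::] => w _; rewrite /tval big_nil. Qed.

Lemma wordfun_sum (I : Type) (r : seq I) (F : I -> wordfun P) w :
  (\sum_(i <- r) F i) w = \sum_(i <- r) F i w.
Proof.
elim: r => [|i r IH]; first by rewrite !big_nil.
rewrite !big_cons -IH; by [].
Qed.

Lemma lie_closure_sum d (I : Type) (r : seq I) (F : I -> wordfun P) :
  (forall i, lie_closure d (F i)) -> lie_closure d (\sum_(i <- r) F i).
Proof.
move=> h; elim: r => [|i r IH]; first by rewrite big_nil; apply: lie_closure0.
by rewrite big_cons; apply: lie_closureD.
Qed.

Lemma lie_elt_multilinear f : lie_elt f -> multilinear f.
Proof.
elim=> [|d f1 f2 /lie_deg_closure/lie_closure_multilinear h1 _ h2] s t k x y.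
  by rewrite mulr0 addr0.
have E w : (f1 + f2) w = f1 w + f2 w by [].
by rewrite !E h1 h2 mulrDr addrACA.
Qed.

Lemma lie_elt_nil f : lie_elt f -> f [::] = 0.
Proof.
elim=> [//|d f1 f2 /lie_deg_closure/lie_closure_nil h1 _ h2].
by have -> : (f1 + f2) [::] = f1 [::] + f2 [::] by []; rewrite h1 h2 addr0.
Qed.

Lemma flP (f : freeLie P) : lie_elt (flval f).
Proof. by have /asboolP := flvalP f. Qed.

Lemma fl_multilinear (f : freeLie P) : multilinear (flval f).
Proof. exact/lie_elt_multilinear/flP. Qed.

Lemma fl_nil (f : freeLie P) : flval f [::] = 0.
Proof. exact/lie_elt_nil/flP. Qed.

Lemma flvalD (f g : freeLie P) w : flval (f + g) w = flval f w + flval g w.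
Proof. by []. Qed.

Lemma flvalB (f g : freeLie P) w : flval (f - g) w = flval f w - flval g w.
Proof. by []. Qed.

Lemma flvalZ k (f : freeLie P) w : flval (k *: f) w = k * flval f w.
Proof. by []. Qed.

Lemma flval_sum (I : Type) (r : seq I) (F : I -> freeLie P) w :
  flval (\sum_(i <- r) F i) w = \sum_(i <- r) flval (F i) w.
Proof.
elim: r => [|i r IH]; first by rewrite !big_nil.
by rewrite !big_cons flvalD IH.
Qed.

Lemma fl_eq (f g : freeLie P) : (forall w, flval f w = flval g w) -> f = g.
Proof. by move=> h; apply: val_inj; apply: wordfun_eq. Qed.

Lemma fl_pred d f : lie_deg d f -> f \in @lie_pred K P.
Proof. by move=> h; apply/asboolP; apply: lie_elt_deg h. Qed.

Definition mkfl d f (h : lie_deg d f) : freeLie P := FreeLie (fl_pred h).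

Lemma mono_fldeg d f : lie_monomial d f -> lie_deg d f.
Proof. by move/monomial_closure/lie_closed_deg. Qed.

End FreeLie.

(** * Extension of identities from monomials by continuity *)

Section Approximation.
Variables (K : gradedField) (P : gmod K).

Record mterm := MTerm { mc : K; me : int; mx : freeLie P; mmon : lie_monomial me (flval mx) }.

Lemma fl_approx (f : freeLie P) (S : seq (seq P)) : exists L : seq mterm,
  forall w, w \in S -> flval f w = \sum_(t <- L) mc t * flval (mx t) w.
Proof.
case: f => f /= /asboolP; elim=> [|d f1 f2 /lie_deg_closure h1 _ [L2 h2]].
  by exists [::] => w _; rewrite big_nil.
have [L1 hL] := h1 S.
pose tr (t : lterm P d) := @MTerm (tc t) (te t) (mkfl (mono_fldeg (tmon t))) (tmon t).
exists ([seq tr t | t <- L1] ++ L2) => w wS.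
rewrite big_cat big_map /= -h2 //.
by have -> : (f1 + f2) w = f1 w + f2 w by []; rewrite hL.
Qed.

Lemma fl_ext (lam : freeLie P -> K) (S : seq (seq P)) (p : pred nat) (f : freeLie P) :
  (forall k f g, lam (k *: f + g) = k * lam f + lam g) ->
  (forall g, (forall u, u \in S -> flval g u = 0) -> lam g = 0) ->
  (forall u, ~~ p (size u) -> flval f u = 0) ->
  (forall e n (x : freeLie P), lie_monomial e (flval x) -> tensor_degree n (flval x) ->
     p n -> lam x = 0) ->
  lam f = 0.
Proof.
move=> lamP hS f0 hE; have [L hL] := fl_approx f S.
have lam0 : lam 0 = 0 by apply: hS.
pose ok (t : mterm) := `[< exists2 n, p n & tensor_degree n (flval (mx t)) >].
pose g : freeLie P := \sum_(t <- [seq t <- L | ok t]) mc t *: mx t.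
have lamg : lam g = 0.
  rewrite /g big_filter; apply: (big_ind (fun x => lam x = 0)) => //.
    by move=> x y hx hy; have := lamP 1 x y; rewrite scale1r mul1r => ->; rewrite hx hy addr0.
  move=> t /asboolP[n pn tn]; rewrite -[_ *: _]addr0 lamP lam0 addr0.
  by rewrite (hE _ _ _ (mmon t) tn pn) mulr0.
rewrite -(subrK g f) -[f - g]scale1r lamP lamg addr0 mul1r.
apply: hS => u uS; rewrite flvalB flval_sum big_filter hL // (bigID ok) /=.
have -> : \sum_(t <- L | ok t) flval (mc t *: mx t) u =
    \sum_(t <- L | ok t) mc t * flval (mx t) u by apply: eq_bigr.
rewrite addrAC subrr add0r; case: (boolP (p (size u))) => pu; last first.
  have := f0 u pu; rewrite hL // (bigID ok) /= big1 ?add0r // => t /asboolP[n pn tn].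
  by rewrite tn ?mulr0 //; apply: contra pu => /eqP ->.
apply: big1 => t /asboolP nt; have [n [_ tn]] := monomial_tensor (mmon t).
rewrite tn ?mulr0 //; apply/eqP => un; apply: nt; exists n => //.
by rewrite -un.
Qed.

(** The map [E] need not be a homomorphism or a derivation: it is enough that its kernel be stable
    under brackets, as for the difference of two derivations along the same homomorphism. *)
Lemma fl_lie_ext (Q : gmod K) (E : {linear freeLie P -> freeLie Q}) : fl_continuous E ->
  (forall d (x : freeLie P), multilinear (flval x) -> tensor_degree 1 (flval x) ->
    form_deg d (flval x) -> E x = 0) ->
  (forall i j f g (hf : fldeg i f) (hg : fldeg j g), E f = 0 -> E g = 0 ->
    E (flbracket hf hg) = 0) ->
  forall f, E f = 0.
Proof.
move=> cE gen br f.
have mon e x : lie_monomial e x -> forall y : freeLie P, flval y = x -> E y = 0.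
  elim=> {e x} [d x mx tx dx|i j x y hx IHx hy IHy] z ez.
    by apply: (gen d); rewrite ez.
  pose X := mkfl (mono_fldeg hx); pose Y := mkfl (mono_fldeg hy).
  have hX : fldeg i X by apply: mono_fldeg.
  have hY : fldeg j Y by apply: mono_fldeg.
  have -> : z = flbracket hX hY by apply: val_inj.
  by apply: br; [apply: IHx|apply: IHy].
apply: fl_eq => w; have [S hS] := cE w.
apply: (@fl_ext (fun f => flval (E f) w) S xpredT) => //.
  by move=> k g h; rewrite linearP.
by move=> e n x hx _ _; rewrite (mon _ _ hx).
Qed.

End Approximation.

(** * Homomorphisms dual to finite sums over words *)

Section Substitution.
Variables (K : gradedField) (P Q : gmod K) (C : seq P -> seq (seq Q)).

Definition subst (f : wordfun Q) : wordfun P := fun w => \sum_(u <- C w) f u.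

Definition lie_subst :=
  (forall f g w, subst (tmul f g) w = tmul (subst f) (subst g) w) /\
  (forall d f, multilinear f -> tensor_degree 1 f -> form_deg d f ->
     lie_closure d (subst f)).

Hypothesis hC : lie_subst.

Lemma subst_bracket i j f g : subst (tbracket i j f g) = tbracket i j (subst f) (subst g).
Proof.
apply: wordfun_eq => w; have [h _] := hC; rewrite tbracketE -!h /subst mulr_sumr -sumrB.
by [].
Qed.

Lemma subst_monomial d x : lie_monomial d x -> lie_closure d (subst x).
Proof.
have [_ h] := hC; elim=> // i j f g _ hf _ hg.
by rewrite subst_bracket; apply: lie_closure_bracket.
Qed.

(** On the words of [W] the image depends on [f] only at the finitely many words of the lists [C w],
    so a finite sum of monomials may stand for [f]. *)
Lemma subst_closure d f : lie_closure d f -> lie_closure d (subst f).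
Proof.
move=> hf; apply: lie_closure_limit => W.
have [L hL] := hf (flatten [seq C w | w <- W]).
exists (\sum_(t <- L) tc t *: (subst (tx t) : wordfun P)).
  apply: lie_closure_sum => t; apply: lie_closureZ (tdeg t) _.
  exact: subst_monomial (tmon t).
move=> w wW; rewrite wordfun_sum.
have E t : (tc t *: (subst (tx t) : wordfun P)) w = tc t * subst (tx t) w by [].
under eq_bigr do rewrite E /subst mulr_sumr.
rewrite exchange_big /= /subst big_seq [RHS]big_seq; apply: eq_bigr => u uC.
by apply: hL; apply/flattenP; exists (C w) => //; apply: map_f.
Qed.

Lemma substD f g : subst (f + g) = subst f + subst g.
Proof.
apply: wordfun_eq => w.
have -> : (subst f + subst g) w = subst f w + subst g w by [].
by rewrite /subst -big_split.
Qed.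

Lemma subst_elt f : f \in @lie_pred K Q -> subst f \in @lie_pred K P.
Proof.
move/asboolP=> hf; apply/asboolP; elim: hf => [|d g h hg _ IH].
  have -> : subst 0 = 0 by apply: wordfun_eq => w; apply: big1.
  exact: lie_elt0.
rewrite substD; apply: lie_eltD IH; apply/lie_closed_deg/subst_closure.
exact/lie_closed_deg/hg.
Qed.

Definition flsubst (f : freeLie Q) : freeLie P := FreeLie (subst_elt (flvalP f)).

Lemma flsubst_linear : linear flsubst.
Proof.
move=> k f g; apply: fl_eq => w.
by rewrite flvalD flvalZ /= /subst mulr_sumr -big_split.
Qed.

HB.instance Definition _ := GRing.isLinear.Build K (freeLie Q) (freeLie P) *:%R
  flsubst flsubst_linear.

Lemma flsubstE f w : flval (flsubst f) w = \sum_(u <- C w) flval f u.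
Proof. by []. Qed.

Lemma flsubst_cont : fl_continuous flsubst.
Proof.
by move=> w; exists (C w) => f hf; rewrite flsubstE big_seq; apply: big1 => u /hf.
Qed.

Lemma flsubst_deg d f : fldeg d f -> fldeg d (flsubst f).
Proof. by move=> /lie_closed_deg hf; apply/lie_closed_deg/subst_closure. Qed.

Lemma flsubst_bracket i j f g (hf : fldeg i f) (hg : fldeg j g) :
  flsubst (flbracket hf hg) = flbracket (flsubst_deg hf) (flsubst_deg hg).
Proof. by apply: val_inj; apply: subst_bracket. Qed.

End Substitution.

(** * Inversion of unipotent substitutions *)

Section Unipotent.
Variables (K : gradedField) (P : gmod K) (C D : seq P -> seq (seq P)).
Hypothesis hC : lie_subst C.
Hypothesis CD : forall f w, subst C f w = f w + subst D f w.
Hypothesis Dsmall : forall w u, u \in D w -> (size u < size w)%N.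

(* sol g solves f + subst D f = g by recursion on the length of words. *)
Fixpoint sol_iter (k : nat) (g : wordfun P) : wordfun P :=
  if k is k'.+1 then fun w => g w - subst D (sol_iter k' g) w else g.

Definition sol (g : wordfun P) : wordfun P := fun w => sol_iter (size w) g w.

Lemma subst_eq f g w : (forall u, (size u < size w)%N -> f u = g u) ->
  subst D f w = subst D g w.
Proof.
move=> h; rewrite /subst big_seq [RHS]big_seq; apply: eq_bigr => u /Dsmall; exact: h.
Qed.

Lemma subst_nil f w : size w = 0%N -> subst D f w = 0.
Proof. by move=> w0; rewrite /subst big_seq; apply: big1 => u /Dsmall; rewrite w0. Qed.

Lemma sol_iter_stable k l g w : (size w <= k)%N -> (size w <= l)%N ->
  sol_iter k g w = sol_iter l g w.
Proof.
elim: k l w => [|k IH] [|l] w //=; rewrite ?leqn0 => hk hl.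
- by rewrite subst_nil ?subr0 //; apply/eqP.
- by rewrite subst_nil ?subr0 //; apply/eqP.
- by congr (_ - _); apply: subst_eq => u hu; apply: IH; lia.
Qed.

Lemma sol_eq g w : sol g w = g w - subst D (sol g) w.
Proof.
rewrite {1}/sol; case e : (size w) => [|n] /=; first by rewrite subst_nil ?subr0.
by congr (_ - _); apply: subst_eq => u hu; apply: sol_iter_stable; lia.
Qed.

Lemma subst_inj f g : subst C f =1 subst C g -> f =1 g.
Proof.
move=> h w; have [n] := ubnP (size w); elim: n w => [//|n IH] w hw.
have := h w; rewrite !CD (subst_eq (g := g)) => [/addIr //|u hu].
by apply: IH; lia.
Qed.

Lemma subst_sol g : subst C (sol g) =1 g.
Proof. by move=> w; rewrite CD {1}sol_eq subrK. Qed.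

(** As [subst D] is not assumed multiplicative, it is not known to preserve Lie sums. But [subst C]
    is, and one round [g - subst D f] of the iteration equals [g - subst C f + f]. *)
Lemma sol_closure d g : lie_closure d g -> lie_closure d (sol g).
Proof.
move=> hg; apply: lie_closure_limit => W; exists (sol_iter (\max_(w <- W) size w) g).
  elim: (\max_(_ <- _) _)%N => [|k IH] //=.
  have -> : (fun w => g w - subst D (sol_iter k g) w) =
      g + (- 1) *: subst C (sol_iter k g) + sol_iter k g :> wordfun P.
    apply: wordfun_eq => w.
    have -> : (g + (- 1) *: subst C (sol_iter k g) + sol_iter k g) w =
      g w + (- 1) * subst C (sol_iter k g) w + sol_iter k g w by [].
    by rewrite CD mulN1r opprD addrA addrAC subrK.
  apply: lie_closureD (IH); apply: lie_closureD => //.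
  apply: (@lie_closureZ _ _ d d); last exact: subst_closure.
  by rewrite subrr -[- 1]add0r; apply: pieceB; [apply: piece0|apply: gf_one].
by move=> w wW; apply: sol_iter_stable => //; apply: leq_bigmax_seq.
Qed.

Lemma solP k f g : sol (k *: f + g) = k *: sol f + sol g.
Proof.
apply: wordfun_eq; apply: subst_inj => w; rewrite subst_sol.
have -> : subst C (k *: sol f + sol g) w = k * subst C (sol f) w + subst C (sol g) w.
  by rewrite /subst mulr_sumr -big_split.
by rewrite !subst_sol.
Qed.

Lemma sol_elt f : f \in @lie_pred K P -> sol f \in @lie_pred K P.
Proof.
move/asboolP=> hf; apply/asboolP; elim: hf => [|d g h hg _ IH].
  have -> : sol 0 = 0; last exact: lie_elt0.
  apply: wordfun_eq; apply: subst_inj => w; rewrite subst_sol.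
  by apply: esym; apply: big1.
have := solP 1 g h; rewrite !scale1r => ->; apply: lie_eltD IH.
by apply/lie_closed_deg/sol_closure/lie_closed_deg; apply: hg.
Qed.

Definition flsol (f : freeLie P) : freeLie P := FreeLie (sol_elt (flvalP f)).

Lemma flsol_linear : linear flsol.
Proof.
by move=> k f g; apply: fl_eq => w; rewrite flvalD flvalZ /= solP.
Qed.

HB.instance Definition _ := GRing.isLinear.Build K (freeLie P) (freeLie P) *:%R
  flsol flsol_linear.

Lemma flsolK f : flsubst hC (flsol f) = f.
Proof. by apply: fl_eq => w; apply: subst_sol. Qed.

Lemma flsubstK f : flsol (flsubst hC f) = f.
Proof. by apply: fl_eq; apply: subst_inj; apply: subst_sol. Qed.

Lemma flsol_deg d f : fldeg d f -> fldeg d (flsol f).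
Proof. by move=> /lie_closed_deg hf; apply/lie_closed_deg/sol_closure. Qed.

Lemma flsol_bracket i j f g (hf : fldeg i f) (hg : fldeg j g) :
  flsol (flbracket hf hg) = flbracket (flsol_deg hf) (flsol_deg hg).
Proof.
rewrite -[RHS]flsubstK flsubst_bracket; congr flsol; apply: val_inj => /=.
by have := flsolK f; have := flsolK g => /(congr1 val) /= -> /(congr1 val) /= ->.
Qed.

Fixpoint sol_dep (n : nat) (w : seq P) : seq (seq P) :=
  w :: (if n is n'.+1 then flatten [seq sol_dep n' u | u <- D w] else [::]).

Lemma sol_depP n w g : (size w <= n)%N -> (forall u, u \in sol_dep n w -> g u = 0) ->
  sol g w = 0.
Proof.
elim: n w => [|n IH] w hw hg; rewrite sol_eq hg ?mem_head //.
  by rewrite subst_nil ?subr0 //; apply/eqP; rewrite -leqn0.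
rewrite /subst big_seq big1 ?subr0 // => u uD.
apply: IH => [|v vu]; first exact: leq_trans (Dsmall uD) hw.
apply: hg; rewrite inE; apply/orP; right; apply/flattenP.
by exists (sol_dep n u) => //; apply: map_f.
Qed.

Lemma flsol_cont : fl_continuous flsol.
Proof. by move=> w; exists (sol_dep (size w) w) => f; apply: sol_depP. Qed.

Lemma flsol_linear_part f v : flval (flsol f) [:: v] = flval f [:: v].
Proof.
(* The only word shorter than a single letter is the empty one, where Lie elements vanish. *)
rewrite /= sol_eq /subst big_seq big1 ?subr0 // => u /Dsmall.
by case: u => // _; apply: (fl_nil (flsol f)).
Qed.

End Unipotent.

(** * Cutting words into blocks *)

Section Cuts.
Variables (K : gradedField) (P Q : gmod K) (Th : seq P -> Q).
Implicit Types (f g : wordfun Q).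

(* The words Th w1, ..., Th wn for all the ways to cut b ++ w in nonempty blocks
   w1, ..., wn such that b is an initial segment of w1 (b being nonempty). *)
Fixpoint cuts_from (b w : seq P) : seq (seq Q) :=
  if w is y :: w' then
    cuts_from (rcons b y) w' ++ [seq Th b :: u | u <- cuts_from [:: y] w']
  else [:: [:: Th b]].

Definition cuts (w : seq P) : seq (seq Q) :=
  if w is y :: w' then cuts_from [:: y] w' else [:: [::]].

Lemma subst_cuts_nil f : subst cuts f [::] = f [::].
Proof. by rewrite /subst big_seq1. Qed.

Lemma subst_cuts_cons b y w f : subst (cuts_from b) f (y :: w) =
  subst (cuts_from (rcons b y)) f w + subst (cuts_from [:: y]) (fun u => f (Th b :: u)) w.
Proof. by rewrite /subst /= big_cat big_map. Qed.

(** A cut word is split either before its first letter, which gives the term with [f [::]], or after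
    the block that contains [b]. In the latter case the split comes from a split of [w], whose
    second part is cut freely. *)
Lemma subst_cuts_from_mul b f g w : subst (cuts_from b) (tmul f g) w =
  f [::] * subst (cuts_from b) g w + tmul (subst (cuts_from b) f) (subst cuts g) w.
Proof.
elim: w b f => [|y w IH] b f.
  by rewrite tmul_nil /subst !big_seq1 tmul_cons tmul_nil.
rewrite subst_cuts_cons IH tmul_cons.
have -> : (fun u => tmul f g (Th b :: u)) =
    (fun u => f [::] * g (Th b :: u) + tmul (fun u => f (Th b :: u)) g u).
  by apply: wordfun_eq => u; rewrite tmul_cons.
have -> : subst (cuts_from [:: y]) (fun u => f [::] * g (Th b :: u) +
      tmul (fun u => f (Th b :: u)) g u) w =
    f [::] * subst (cuts_from [:: y]) (fun u => g (Th b :: u)) w +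
    subst (cuts_from [:: y]) (tmul (fun u => f (Th b :: u)) g) w.
  by rewrite /subst mulr_sumr -big_split.
rewrite IH subst_cuts_cons mulrDr -!addrA; congr (_ + _).
rewrite addrCA; congr (_ + _).
have -> : (fun u => subst (cuts_from b) f (y :: u)) =
    subst (cuts_from (rcons b y)) f + subst (cuts_from [:: y]) (fun u => f (Th b :: u)).
  by apply: wordfun_eq => u; rewrite subst_cuts_cons.
rewrite tmulDl addrCA; congr (_ + _).
have -> : subst (cuts_from b) f [::] = f [:: Th b] by rewrite /subst big_seq1.
by [].
Qed.

Lemma subst_cuts_mul f g w :
  subst cuts (tmul f g) w = tmul (subst cuts f) (subst cuts g) w.
Proof.
case: w => [|y w]; first by rewrite tmul_nil !subst_cuts_nil tmul_nil.
by rewrite tmul_cons subst_cuts_nil; apply: subst_cuts_from_mul.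
Qed.

Lemma cuts_from_size b w u : u \in cuts_from b w -> (0 < size u <= (size w).+1)%N.
Proof.
elim: w b u => [|y w IH] b u /=; first by rewrite inE => /eqP ->.
rewrite mem_cat => /orP[/IH/andP[-> h]|/mapP[v /IH/andP[_ hv] ->]] //=.
exact: leqW.
Qed.

(** Only the cut into a single block yields a one-letter word. Thus [Th] is the transpose of the
    homomorphism on linear forms. *)
Lemma subst_cuts1 f v w : tensor_degree 1 f -> subst cuts f (v :: w) = f [:: Th (v :: w)].
Proof.
move=> tf; rewrite -[v :: w]/([:: v] ++ w).
have -> : subst cuts f ([:: v] ++ w) = subst (cuts_from [:: v]) f w by [].
elim: w [:: v] => [|y w IH] b; first by rewrite /subst big_seq1 cats0.
rewrite subst_cuts_cons IH cat_rcons /subst big_seq big1 ?addr0 // => u.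
by case/cuts_from_size/andP; case: u => // a u _ _; apply: tf.
Qed.

End Cuts.

Section ShortCuts.
Variables (K : gradedField) (P : gmod K) (Th : seq P -> P).
Hypothesis Th1 : forall v, Th [:: v] = v.

(** All cuts except the one whose first block is [b] alone and whose other blocks are single
    letters. As [Th] fixes letters, for a one-letter [b] the omitted cut gives back the word
    itself. *)
Fixpoint short_cuts_from (b w : seq P) : seq (seq P) :=
  if w is y :: w' then
    cuts_from Th (rcons b y) w' ++ [seq Th b :: u | u <- short_cuts_from [:: y] w']
  else [::].

Definition short_cuts (w : seq P) : seq (seq P) :=
  if w is y :: w' then short_cuts_from [:: y] w' else [::].

Lemma cuts_short f w : subst (cuts Th) f w = f w + subst short_cuts f w.
Proof.
case: w => [|y w]; first by rewrite /subst big_seq1 big_nil addr0.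
rewrite /subst /= -[in X in f X](Th1 y); elim: w [:: y] f => [|z w IH] b f /=.
  by rewrite big_seq1 big_nil addr0.
rewrite !big_cat !big_map /= (IH [:: z] (fun u => f (Th b :: u))) Th1.
by rewrite addrCA.
Qed.

Lemma short_cuts_size w u : u \in short_cuts w -> (size u < size w)%N.
Proof.
case: w => [//|y w] /=; elim: w [:: y] u => [//|z w IH] b u /=.
by rewrite mem_cat => /orP[/cuts_from_size/andP[]|/mapP[v /IH hv ->]].
Qed.

End ShortCuts.

(** * Homomorphisms induced by linear maps *)

Section Pullback.
Variables (K : gradedField) (P Q : gmod K) (A : {linear P -> Q}).
Hypothesis hA : forall i v, gdeg i v -> gdeg i (A v).

Lemma pull_subst : lie_subst (fun w => [:: map A w]).
Proof.
split=> [f g w|d f mf tf df]; rewrite /subst.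
  rewrite big_seq1 /tmul size_map; apply: eq_bigr => i _.
  by rewrite !big_seq1 map_take map_drop.
apply: monomial_closure; apply: lie_gen.
- by move=> s t k x y; rewrite !big_seq1 !map_cat /= linearP; apply: mf.
- by move=> w hw; rewrite big_seq1; apply: tf; rewrite size_map.
- move=> es w [hs hw]; rewrite big_seq1; apply: df; split; first by rewrite size_map.
  by move=> i; rewrite size_map => iw; rewrite (nth_map 0) //; apply/hA/hw.
Qed.

End Pullback.

(** * Duals of continuous maps and the contraction of the linear part *)

Section LinearForms.
Variables (K : gradedField) (P : gmod K).

Lemma multilinear1_sum (f : wordfun P) (I : Type) (r : seq I) (k : I -> K) (x : I -> P) :
  multilinear f -> f [:: \sum_(i <- r) k i *: x i] = \sum_(i <- r) k i * f [:: x i].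
Proof.
move=> mf; elim: r => [|i r IH].
  rewrite !big_nil; have := mf [::] [::] 1 0 0; rewrite scale1r addr0 mul1r.
  by move/esym/eqP; rewrite -subr_eq0 addrK => /eqP.
by rewrite !big_cons -IH; apply: (mf [::] [::]).
Qed.

Lemma multilinear1_0 (f : wordfun P) : multilinear f -> f [:: 0] = 0.
Proof.
by move=> mf; have := multilinear1_sum ([::] : seq nat) (fun=> 0) (fun=> 0) mf; rewrite !big_nil.
Qed.

Lemma multilinear1B (f : wordfun P) x y : multilinear f ->
  f [:: x - y] = f [:: x] - f [:: y].
Proof.
move=> mf; have := mf [::] [::] (- 1) y x.
by rewrite /= scaleN1r mulN1r addrC [in RHS]addrC.
Qed.

Section Coord.
Variables (B : set P) (hB : gbasis B).

Lemma dual_deg b : kdeg (- bdeg hB b + bdeg hB b) (1 : K).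
Proof. by rewrite addNr; apply: gf_one. Qed.

Lemma dual_monomial b : lie_monomial (- bdeg hB b) (coord_form hB b 1).
Proof. exact: coord_form_gen (dual_deg b). Qed.

Definition dual_form b : freeLie P := mkfl (mono_fldeg (dual_monomial b)).

Lemma coord_homogeneous j v :
  (forall b, kdeg (j - bdeg hB b) (coord hB v b)) -> gdeg j v.
Proof.
move=> h; have [_ hv _ ->] := coordP hB v.
elim: (csupp hB v) hv => [|b r IH] /= hv; first by rewrite big_nil; apply: piece0.
rewrite big_cons; apply: pieceD; last by apply: IH => a ar; apply: hv; rewrite inE ar orbT.
have Bb : B b by apply: hv; rewrite mem_head.
by have := gm_scale (h b) (bdegP hB Bb); rewrite subrK.
Qed.

Lemma form_sep (x y : P) :
  (forall d (f : freeLie P), lie_monomial d (flval f) -> tensor_degree 1 (flval f) ->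
     flval f [:: x] = flval f [:: y]) -> x = y.
Proof.
move=> h; apply: (coord_inj (hB := hB)) => b.
have t1 : tensor_degree 1 (coord_form hB b 1) by move=> [|? [|? ?]].
by have := h _ (dual_form b) (dual_monomial b) t1; rewrite /= !mul1r.
Qed.

(** By continuity the value at [w] depends on [f] at finitely many vectors, hence on finitely many
    coordinates [f [:: b]]. So the functional is evaluation at a vector of [P], and not merely an
    element of the bidual. *)
Lemma dual_word_ex (Q : gmod K) (E : {linear freeLie P -> freeLie Q}) (w : seq Q) :
  fl_continuous E -> exists p : P, forall f : freeLie P, tensor_degree 1 (flval f) ->
  flval (E f) w = flval f [:: p].
Proof.
move=> cE; have [S hS] := cE w.
pose T := undup (flatten [seq csupp hB v | v <- flatten S]).
exists (\sum_(b <- T) flval (E (dual_form b)) w *: b) => f tf.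
rewrite multilinear1_sum; last exact: fl_multilinear.
apply/eqP; rewrite -subr_eq0.
pose g := f - \sum_(b <- T) flval f [:: b] *: dual_form b.
have : flval (E g) w = 0.
  apply: hS => -[|v [|v' u]] uS; first exact: fl_nil.
    rewrite flvalB flval_sum [X in flval f [:: X]](@coord_sum _ _ _ hB v T).
    - rewrite multilinear1_sum; last exact: fl_multilinear.
      by rewrite -sumrB big1 // => b _; rewrite flvalZ /= mul1r mulrC subrr.
    - exact: undup_uniq.
    - move=> b bv; rewrite mem_undup; apply/flattenP; exists (csupp hB v) => //.
      by apply: map_f; apply/flattenP; exists [:: v]; rewrite ?mem_head.
  rewrite flvalB flval_sum tf // big1 ?subrr // => b _.
  by rewrite flvalZ /= mulr0.
rewrite linearB flvalB linear_sum flval_sum => /eqP.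
congr (_ - _ == 0); apply: eq_bigr => b _.
by rewrite linearZ flvalZ mulrC.
Qed.

End Coord.

Section Dual.
Variables (Q : gmod K) (E : {linear freeLie P -> freeLie Q}) (cE : fl_continuous E).

Lemma dual_word_sig (w : seq Q) : exists p : P, forall f : freeLie P,
  tensor_degree 1 (flval f) -> flval (E f) w = flval f [:: p].
Proof. by have [B hB] := gbasis_ex P; apply: (dual_word_ex hB). Qed.

(** The transpose of [E] on linear forms. For the derivation of an algebra, its values on words of
    length n are the n-ary operation, up to suspension and signs. *)
Definition dual_word (w : seq Q) : P := projT1 (cid (dual_word_sig w)).

Lemma dual_wordE w (f : freeLie P) : tensor_degree 1 (flval f) ->
  flval (E f) w = flval f [:: dual_word w].
Proof. exact: projT2 (cid (dual_word_sig w)) f. Qed.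

Definition lin_dual (v : Q) : P := dual_word [:: v].

Lemma lin_dual_linear : linear lin_dual.
Proof.
move=> k v w; have [B hB] := gbasis_ex P; apply: (form_sep hB) => d f _ tf.
rewrite -dual_wordE // (fl_multilinear f [::] [::]) -!dual_wordE //.
exact: (fl_multilinear (E f) [::] [::]).
Qed.

HB.instance Definition _ := GRing.isLinear.Build K Q P *:%R lin_dual lin_dual_linear.

Lemma lin_dual_deg n : (forall d f, fldeg d f -> fldeg (d + n) (E f)) ->
  forall i v, gdeg i v -> gdeg (i + n) (lin_dual v).
Proof.
move=> hE i v hv; have [B hB] := gbasis_ex P.
apply: (coord_homogeneous (hB := hB)) => b.
have t1 : tensor_degree 1 (coord_form hB b 1) by move=> [|? [|? ?]].
have hd : fldeg (- bdeg hB b) (dual_form hB b) by apply: mono_fldeg; apply: dual_monomial.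
have := lie_closure_deg (lie_deg_closure (hE _ _ hd)).
move/(_ [:: i] [:: v]); rewrite dual_wordE //= mul1r big_seq1 /kdeg.
have -> : - bdeg hB b + n + i = i + n - bdeg hB b by lia.
by apply; split=> //; case.
Qed.

End Dual.

Definition lform (A : P -> P) (f : wordfun P) : wordfun P :=
  fun w => if w is [:: v] then f [:: A v] else 0.

Lemma lform_tensor A f : tensor_degree 1 (lform A f).
Proof. by move=> [|? [|? ?]]. Qed.

Lemma lform_gen (A : {linear P -> P}) n d f :
  (forall i v, gdeg i v -> gdeg (i + n) (A v)) ->
  multilinear f -> form_deg d f -> lie_monomial (d + n) (lform A f).
Proof.
move=> hA mf df; apply: lie_gen; last 2 first.
- exact: lform_tensor.
- move=> es [|v [|v' w]] [hs h]; rewrite /lform; try exact: piece0.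
  case: es hs h => [|e [|e' es]] // _ /(_ 0%N isT) /= h.
  have := df [:: e + n] [:: A v]; rewrite !big_seq1.
  have -> : d + (e + n) = d + n + e by lia.
  by apply; split=> //; case=> // _; apply: hA.
move=> [|a [|a' s]] [|b' t] l x y; rewrite /lform /= ?mulr0 ?addr0 //.
by rewrite linearP; apply: (mf [::] [::]).
Qed.

End LinearForms.

(** * Contraction of a differential *)

Section GeneralizedInverse.
Variables (K : gradedField) (P : gmod K) (d : {linear P -> P}).
Hypothesis dd : forall v, d (d v) = 0.
Hypothesis ddeg : forall i v, gdeg i v -> gdeg (i + 1) (d v).

(** A basis [X] of the image, made of values of [d] at homogeneous vectors, is extended to a basis
    of [P]; elements of [X] go to homogeneous preimages, the other basis vectors to any vectors of
    the right degree. *)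
Lemma section_on_image : exists h : {linear P -> P},
  (forall i v, gdeg i v -> gdeg (i - 1) (h v)) /\ (forall v, d (h (d v)) = d v).
Proof.
pose T (t : P) := exists i v, gdeg i v /\ t = d v.
have hT : homogeneous T by move=> t [i [v [hv ->]]]; exists (i + 1); apply: ddeg.
have [X [_ XT iX sX]] : exists X, [/\ (set0 `<=` X)%classic, (X `<=` T)%classic,
    indep X & forall t, T t -> spanned X t].
  by apply: extend_indep => // s c _ hs _ b /hs.
have [B [XB hB]] := extend_gbasis (fun b Xb => hT b (XT b Xb)) iX.
have Gex b : exists v, (B b -> gdeg (bdeg hB b - 1) v) /\ (X b -> d v = b).
  have [Xb|nX] := pselect (X b); last by exists 0; split=> // _; apply: piece0.
  have [i [v [hv bE]]] := XT _ Xb.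
  have [e|ne] := eqVneq (i + 1) (bdeg hB b).
    by exists v; split=> // _; rewrite -e addrK.
  (* Here [b] is homogeneous of two different degrees, so it is zero and has preimage zero. *)
  exists 0; split=> [_|_]; first exact: piece0.
  have b1 := gcomp_piece (ddeg hv) (i + 1); rewrite eqxx -bE in b1.
  have := gcomp_piece (bdegP hB (XB _ Xb)) (i + 1).
  by rewrite b1 (negbTE ne) linear0.
pose G b := projT1 (cid (Gex b)).
have [Gd GX] : (forall b, B b -> gdeg (bdeg hB b - 1) (G b)) /\ (forall b, X b -> d (G b) = b).
  by split=> b; rewrite /G; case: cid => v [].
have [h [hdeg hX]] : exists h : {linear P -> P},
    (forall i v, gdeg i v -> gdeg (i - 1) (h v)) /\ (forall b, X b -> d (h b) = b).
  exists (lin_ext hB G); split; first exact: lin_ext_deg.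
  by move=> b Xb /=; rewrite lin_ext_basis ?GX //; apply: XB.
exists h; split=> //.
move=> v; have [s [_ ->]] := gcomp_sum (gm_grading P) v.
rewrite !linear_sum; apply: eq_bigr => i _.
have [|r [c [hr ->]]] := sX (d (gcomp (gm_grading P) i v)).
  by exists i, (gcomp (gm_grading P) i v); split=> //; apply: gcompP.
rewrite !linear_sum big_seq [RHS]big_seq; apply: eq_bigr => b /hr Xb.
by rewrite !linearZ /= hX.
Qed.

(** Two corrections of a section [h0] on the image: [h1 = h0 d h0] satisfies [h1 d h1 = h1], and
    [h1 - d h1 h1] moreover squares to zero. The second keeps the earlier identities because
    [d d = 0]. *)
Lemma hodge : exists h : {linear P -> P},
  [/\ (forall i v, gdeg i v -> gdeg (i - 1) (h v)), (forall v, d (h (d v)) = d v),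
      (forall v, h (d (h v)) = h v) & (forall v, h (h v) = 0)].
Proof.
have [h0 [deg0 dhd0]] := section_on_image.
have [h1 [deg1 dhd1 hdh1]] : exists h1 : {linear P -> P},
    [/\ (forall i v, gdeg i v -> gdeg (i - 1) (h1 v)),
        (forall v, d (h1 (d v)) = d v) & (forall v, h1 (d (h1 v)) = h1 v)].
  exists (h0 \o d \o h0); split=> [i v hv|v|v] /=; rewrite ?dhd0 //.
  by apply: (deg0); have := ddeg (deg0 _ _ hv); rewrite subrK.
pose h : {linear P -> P} := h1 \- (d \o h1 \o h1).
have hE v : h v = h1 v - d (h1 (h1 v)) by [].
exists h; split=> [i v hv|v|v|v]; rewrite !hE.
- apply: pieceB; first exact: deg1.
  by have := ddeg (deg1 _ _ (deg1 _ _ hv)); rewrite subrK.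
- by rewrite linearB dd subr0.
- have -> : d (h1 v - d (h1 (h1 v))) = d (h1 v) by rewrite linearB dd subr0.
  by rewrite hdh1.
- have -> : h1 (h1 v - d (h1 (h1 v))) = 0 by rewrite linearB hdh1 subrr.
  by rewrite !linear0 addr0.
Qed.

End GeneralizedInverse.

(** * The minimal model *)

Section FixedModule.
Variables (K : gradedField) (V : gmod K) (e : {linear V -> V}).

Definition fix_pred : {pred V} := fun v => e v == v.

Lemma fix_submod_closed : submod_closed fix_pred.
Proof.
split; first by apply/eqP; rewrite linear0.
by move=> k v w /eqP hv /eqP hw; apply/eqP; rewrite linearP hv hw.
Qed.

HB.instance Definition _ := GRing.isSubmodClosed.Build K V fix_pred fix_submod_closed.

Record fixed := Fixed { fixval :> V; fixvalP : fixval \in fix_pred }.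

HB.instance Definition _ := [isSub for fixval].
HB.instance Definition _ := [Choice of fixed by <:].
HB.instance Definition _ := [SubChoice_isSubLmodule of fixed by <:].

Lemma fixvalE (u : fixed) : e (fixval u) = fixval u.
Proof. by have /eqP := fixvalP u. Qed.

Definition fix_incl (u : fixed) : V := fixval u.

Lemma fix_incl_linear : linear fix_incl.
Proof. by []. Qed.

HB.instance Definition _ := GRing.isLinear.Build K fixed V *:%R fix_incl fix_incl_linear.

Hypothesis edeg : forall i v, gdeg i v -> gdeg i (e v).
Hypothesis ee : forall v, e (e v) = e v.

Lemma fix_proj_subproof v : e v \in fix_pred.
Proof. by apply/eqP; rewrite ee. Qed.

Definition fix_proj (v : V) : fixed := Fixed (fix_proj_subproof v).

Lemma fix_proj_linear : linear fix_proj.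
Proof. by move=> k v w; apply: val_inj; rewrite /= linearP. Qed.

HB.instance Definition _ := GRing.isLinear.Build K V fixed *:%R fix_proj fix_proj_linear.

Definition fix_piece i (u : fixed) := gdeg i (fix_incl u).

Lemma fix_piece0 i : fix_piece i 0.
Proof. exact: piece0. Qed.

Lemma fix_pieceB i x y : fix_piece i x -> fix_piece i y -> fix_piece i (x - y).
Proof. by move=> hx hy; rewrite /fix_piece linearB; apply: pieceB. Qed.

Lemma fix_span (x : fixed) : exists (s : seq int) (c : int -> fixed),
  (forall i, fix_piece i (c i)) /\ x = \sum_(i <- s) c i.
Proof.
have [s [_ hs]] := gcomp_sum (gm_grading V) (fix_incl x).
exists s, (fun i => fix_proj (gcomp (gm_grading V) i (fix_incl x))); split=> [i|].
  by apply: edeg; apply: gcompP.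
by rewrite -linear_sum -hs; apply: val_inj; rewrite /= fixvalE.
Qed.

Lemma fix_indep (s : seq int) (c : int -> fixed) :
  uniq s -> (forall i, fix_piece i (c i)) -> \sum_(i <- s) c i = 0 ->
  forall i, i \in s -> c i = 0.
Proof.
move=> us hc /(congr1 fix_incl); rewrite linear_sum linear0 => S0 i si.
by apply: val_inj; apply: (piece_indep us hc S0 si).
Qed.

Definition fix_grading : grading fixed :=
  Grading fix_piece0 fix_pieceB fix_span fix_indep.

Lemma fix_scale i j (k : K) (u : fixed) : kdeg i k -> fix_piece j u ->
  fix_piece (i + j) (k *: u).
Proof. by move=> hk hu; rewrite /fix_piece linearZ; apply: gm_scale. Qed.

Definition fix_gmod : gmod K := @GMod K fixed fix_grading fix_scale.

End FixedModule.

Lemma fl_cont_comp (K : gradedField) (P Q R : gmod K)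
    (f : {linear freeLie P -> freeLie Q}) (g : {linear freeLie Q -> freeLie R}) :
  fl_continuous f -> fl_continuous g -> fl_continuous (g \o f).
Proof.
move=> cf cg w; have [S hS] := cg w.
pose T u := projT1 (cid (cf u)).
have hT u x : (forall s, s \in T u -> flval x s = 0) -> flval (f x) u = 0.
  exact: projT2 (cid (cf u)) x.
exists (flatten [seq T u | u <- S]) => x hx /=; apply: hS => u uS; apply: hT => s su.
by apply: hx; apply/flattenP; exists (T u) => //; apply: map_f.
Qed.

Lemma fl_contB (K : gradedField) (P Q : gmod K) (f g : {linear freeLie P -> freeLie Q}) :
  fl_continuous f -> fl_continuous g -> fl_continuous (f \- g).
Proof.
move=> cf cg w; have [S hS] := cf w; have [T hT] := cg w; exists (S ++ T) => x hx.
have -> : flval ((f \- g) x) w = flval (f x) w - flval (g x) w by [].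
by rewrite hS ?hT ?subrr // => s sS; apply: hx; rewrite mem_cat sS ?orbT.
Qed.

Lemma eq_flbracket (K : gradedField) (P : gmod K) i j (f f' g g' : freeLie P)
    (hf : fldeg i f) (hg : fldeg j g) (hf' : fldeg i f') (hg' : fldeg j g') :
  f = f' -> g = g' -> flbracket hf hg = flbracket hf' hg'.
Proof. by move=> ef eg; apply: val_inj; rewrite /= ef eg. Qed.

(** * The linear part of the differential *)

Section Derivation.
Variables (K : gradedField) (V : gmod K) (m : cinf_structure V).
Local Notation P := (susp V).

(** A derivation sends a bracket to a sum of brackets, and brackets vanish on one-letter words
    because Lie elements vanish on the empty word. So the linear part of [m g] depends only on that
    of [g]. *)
Lemma der_linear_part (g : freeLie P) v :
  flval (m g) [:: v] = flval g [:: lin_dual (ci_cont m) v].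
Proof.
set d := lin_dual _; apply/eqP; rewrite -subr_eq0; apply/eqP.
have [S hS] := ci_cont m [:: v].
apply: (@fl_ext _ _ (fun g => flval (m g) [:: v] - flval g [:: d v]) ([:: d v] :: S) xpredT).
- move=> k x y; rewrite linearP !flvalD !flvalZ.
  by rewrite mulrBr opprD addrACA.
- move=> x hx; rewrite hS ?hx ?mem_head ?subrr // => s sS.
  by apply: hx; rewrite inE sS orbT.
- by [].
move=> i n x hx tn _; have [e|n1] := eqVneq n 1%N.
  by rewrite e in tn; rewrite (dual_wordE (ci_cont m)) // subrr.
rewrite [X in _ - X]tn ?subr0; last by rewrite eq_sym.
move: hx tn; move e : (flval x) => X hx.
(* A generator that also has a tensor degree other than 1 is the zero form. *)
case: hx e => {i X} [i X _ t1 _|i j x1 x2 hf hg] e tX.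
  have -> : x = 0; last by rewrite linear0.
  apply: fl_eq => w; rewrite e; have [w1|/t1 //] := eqVneq (size w) 1%N.
  by rewrite tX // w1 eq_sym.
pose F := mkfl (mono_fldeg hf); pose G := mkfl (mono_fldeg hg).
have hF : fldeg i F by apply: mono_fldeg.
have hG : fldeg j G by apply: mono_fldeg.
have -> : x = flbracket hF hG by apply: val_inj.
rewrite ci_der flvalD flvalZ.
have br0 i' j' (A B : freeLie P) (hA : fldeg i' A) (hB : fldeg j' B) :
    flval (flbracket hA hB) [:: v] = 0.
  by apply: tbracket_eq0 => -[|[|l]] /=; rewrite fl_nil ?mul0r ?mulr0.
by rewrite !br0 mulr0 addr0.
Qed.

Local Notation d := (lin_dual (ci_cont m)).

Lemma der_lin_sq v : d (d v) = 0.
Proof.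
have [B hB] := gbasis_ex P; apply: (form_sep hB) => i f _ _.
by rewrite -!der_linear_part ci_sq multilinear1_0 //; apply: fl_multilinear.
Qed.

Lemma der_lin_deg i v : gdeg i v -> gdeg (i + 1) (d v).
Proof. by apply: lin_dual_deg => j f; apply: ci_deg. Qed.

End Derivation.

(** * Straightening the differential and passing to the cohomology *)

Section Minimal.
Variables (K : gradedField) (V : gmod K) (m : cinf_structure V).
Local Notation P := (susp V).
Local Notation d := (lin_dual (ci_cont m)).
Local Notation M := (dual_word (ci_cont m)).
Variable h : {linear P -> P}.
Hypothesis hdeg : forall i v, gdeg i v -> gdeg (i - 1) (h v).
Hypothesis dhd : forall v, d (h (d v)) = d v.
Hypothesis hdh : forall v, h (d (h v)) = h v.
Hypothesis hh : forall v, h (h v) = 0.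

(** On longer words, [f] at [h (M w)] is the value of [m (f h)] at [w]. On a letter [v] the formula
    [f (id - h d) + m (f h)] gives [f (v - h d v) + f (h d v) = f v], whence the first case. *)
Definition straighten (w : seq P) : P := if w is [:: v] then v else h (M w).

Definition hproj : {linear P -> P} := idfun \- (d \o h) \- (h \o d).

Lemma hprojE v : hproj v = v - d (h v) - h (d v).
Proof. by []. Qed.

Lemma dhdeg i v : gdeg i v -> gdeg i (d (h v)).
Proof. by move=> /hdeg/(der_lin_deg m); rewrite subrK. Qed.

Lemma hddeg i v : gdeg i v -> gdeg i (h (d v)).
Proof. by move=> /(der_lin_deg m)/hdeg; rewrite addrK. Qed.

Lemma hproj_deg i v : gdeg i v -> gdeg i (hproj v).
Proof.
by move=> hv; rewrite hprojE; apply: pieceB; [apply: pieceB => //; apply: dhdeg|apply: hddeg].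
Qed.

Lemma d_hproj v : d (hproj v) = 0.
Proof. by rewrite hprojE !linearB /= der_lin_sq dhd subr0 subrr. Qed.

Lemma hproj_d v : hproj (d v) = 0.
Proof. by rewrite hprojE dhd der_lin_sq linear0 subr0 subrr. Qed.

Lemma h_hproj v : h (hproj v) = 0.
Proof. by rewrite hprojE !linearB /= hdh hh subr0 subrr. Qed.

Lemma hproj_idem v : hproj (hproj v) = hproj v.
Proof. by rewrite {1}hprojE h_hproj d_hproj !linear0 !addr0. Qed.

(** The image of a generator [f] is the generator [f (id - h d)] plus the value of [m] at the
    generator [f h]. Since [m] preserves Lie sums, so does the substitution; [h] lowers the degree
    by one and [m] restores it. *)
Lemma straighten_subst : lie_subst (cuts straighten).
Proof.
split=> [f g w|i f mf tf df]; first exact: subst_cuts_mul.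
have fA : lie_monomial (i + 0) (lform (idfun \- (h \o d)) f).
  apply: lform_gen => // j v hv; rewrite addr0 /=; apply: pieceB => //.
  exact: hddeg.
have fh : lie_monomial (i - 1) (lform h f) by apply: lform_gen.
pose F := mkfl (mono_fldeg fh).
have hF : fldeg (i - 1) F by apply: mono_fldeg.
have hmF := ci_deg m hF; rewrite subrK in hmF; rewrite addr0 in fA.
have -> : subst (cuts straighten) f = lform (idfun \- (h \o d)) f + flval (m F).
  apply: wordfun_eq => w.
  have -> : (lform (idfun \- (h \o d)) f + flval (m F)) w =
    lform (idfun \- (h \o d)) f w + flval (m F) w by [].
  rewrite (dual_wordE (ci_cont m)); last exact: lform_tensor.
  case: w => [|v w].
    rewrite subst_cuts_nil tf //= add0r -[LHS](fl_nil (m F)).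
    by rewrite (dual_wordE (ci_cont m)) //; apply: lform_tensor.
  rewrite subst_cuts1 //; case: w => [|v' w] /=; last by rewrite add0r.
  by rewrite (multilinear1B _ _ mf) subrK.
by apply: lie_closureD; [apply: monomial_closure|apply/lie_closed_deg].
Qed.

Lemma straighten1 v : straighten [:: v] = v. Proof. by []. Qed.

Definition Psi : {linear freeLie P -> freeLie P} := flsubst straighten_subst.

Definition psi : {linear freeLie P -> freeLie P} :=
  flsol straighten_subst (cuts_short straighten1) (@short_cuts_size _ _ straighten).

Lemma PsiK f : Psi (psi f) = f. Proof. exact: flsolK. Qed.

Lemma psiK f : psi (Psi f) = f. Proof. exact: flsubstK. Qed.

(* As [straighten] is dual to f |-> f (id - h d) + m (f h), the map Psi fixes the linear
   forms f with f = f d h, and sends f d to m f. *)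
Lemma der_Psi (f fd : freeLie P) : tensor_degree 1 (flval f) ->
  (forall v, flval f [:: d (h v)] = flval f [:: v]) ->
  flval fd = lform d (flval f) -> m (Psi f) = Psi fd.
Proof.
move=> tf fdh efd.
have -> : Psi f = f.
  apply: fl_eq => -[|v w]; first by rewrite !fl_nil.
  rewrite [LHS]subst_cuts1 //; case: w => [//|v' w].
  (* On a longer word the left side is [f] at a value of [h], and [f = f d h] kills such values
     because [h h = 0]. *)
  rewrite [RHS]tf //= -fdh hh linear0 multilinear1_0 //; exact: fl_multilinear.
apply: fl_eq => -[|v w]; first by rewrite !fl_nil.
rewrite (dual_wordE (ci_cont m)) // [RHS]subst_cuts1 ?efd; last exact: lform_tensor.
by case: w => [//|v' w] /=; rewrite fdh.
Qed.

Definition der' : {linear freeLie P -> freeLie P} := psi \o m \o Psi.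

Lemma der'E f : der' f = psi (m (Psi f)). Proof. by []. Qed.

Lemma der'_sq f : der' (der' f) = 0.
Proof. by rewrite !der'E PsiK ci_sq linear0. Qed.

Lemma Psi_deg i f : fldeg i f -> fldeg i (Psi f). Proof. exact: flsubst_deg. Qed.

Lemma psi_deg i f : fldeg i f -> fldeg i (psi f). Proof. exact: flsol_deg. Qed.

Lemma der'_deg i f : fldeg i f -> fldeg (i + 1) (der' f).
Proof. by move=> hf; apply/psi_deg/ci_deg/Psi_deg. Qed.

Lemma Psi_bracket i j f g (hf : fldeg i f) (hg : fldeg j g) :
  Psi (flbracket hf hg) = flbracket (Psi_deg hf) (Psi_deg hg).
Proof. by rewrite [LHS]flsubst_bracket; apply: eq_flbracket. Qed.

Lemma psi_bracket i j f g (hf : fldeg i f) (hg : fldeg j g) :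
  psi (flbracket hf hg) = flbracket (psi_deg hf) (psi_deg hg).
Proof. by rewrite [LHS]flsol_bracket; apply: eq_flbracket. Qed.

Lemma der'_der i j f g (hf : fldeg i f) (hg : fldeg j g) :
  der' (flbracket hf hg) =
    flbracket (der'_deg hf) hg + ksign K i *: flbracket hf (der'_deg hg).
Proof.
rewrite der'E Psi_bracket ci_der linearD linearZ /= !psi_bracket.
by congr (_ + _ *: _); apply: eq_flbracket => //; apply: psiK.
Qed.

Lemma der'_lform i (f : freeLie P) : lie_monomial i (flval f) ->
  tensor_degree 1 (flval f) -> (forall v, flval f [:: d (h v)] = flval f [:: v]) ->
  flval (der' f) = lform d (flval f).
Proof.
move=> hf tf fdh.
have hd := lform_gen (der_lin_deg m) (monomial_multilinear hf) (monomial_deg hf).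
by rewrite der'E (@der_Psi f (mkfl (mono_fldeg hd))) // psiK.
Qed.

Lemma der'_cont : fl_continuous der'.
Proof.
apply: fl_cont_comp; first exact: flsubst_cont.
by apply: fl_cont_comp; [apply: ci_cont|apply: flsol_cont].
Qed.

Lemma psi_lin f v : flval (psi f) [:: v] = flval f [:: v].
Proof. exact: flsol_linear_part. Qed.

(** [susp V] and [V] have the same total module, so the projection is reused on [V], where only the
    degrees are shifted. *)
Definition hV : {linear V -> V} := hproj.

Lemma hV_deg i (v : V) : gdeg i v -> gdeg i (hV v).
Proof.
have := @hproj_deg (i - 1) v; rewrite /gdeg /=.
by rewrite subrK.
Qed.

Definition coh : gmod K := fix_gmod hV_deg hproj_idem.
Local Notation U := (susp coh).

Definition incl : {linear U -> P} := @fix_incl K V hV.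
Definition proj : {linear P -> U} := (@fix_proj K V hV hproj_idem : {linear V -> fixed hV}).

Lemma incl_deg i v : gdeg i v -> gdeg i (incl v). Proof. by []. Qed.

Lemma proj_deg i v : gdeg i v -> gdeg i (proj v).
Proof. exact: hproj_deg. Qed.

Lemma proj_incl u : proj (incl u) = u.
Proof. by apply: val_inj; apply: fixvalE. Qed.

Lemma hproj_incl (u : U) : hproj (incl u) = incl u.
Proof. exact: (@fixvalE K V hV u). Qed.

Lemma incl_proj v : incl (proj v) = hproj v. Proof. by []. Qed.

Definition Pi : {linear freeLie P -> freeLie U} := flsubst (pull_subst incl_deg).
Definition Io : {linear freeLie U -> freeLie P} := flsubst (pull_subst proj_deg).

Lemma PiE f w : flval (Pi f) w = flval f (map incl w).
Proof. by rewrite [LHS]flsubstE big_seq1. Qed.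

Lemma IoE f w : flval (Io f) w = flval f (map proj w).
Proof. by rewrite [LHS]flsubstE big_seq1. Qed.

Lemma PiIo f : Pi (Io f) = f.
Proof.
apply: fl_eq => w; rewrite PiE IoE -map_comp map_id_in // => u _.
exact: proj_incl.
Qed.

Lemma Pi_deg i f : fldeg i f -> fldeg i (Pi f). Proof. exact: flsubst_deg. Qed.

Lemma Io_deg i f : fldeg i f -> fldeg i (Io f). Proof. exact: flsubst_deg. Qed.

Lemma Pi_bracket i j f g (hf : fldeg i f) (hg : fldeg j g) :
  Pi (flbracket hf hg) = flbracket (Pi_deg hf) (Pi_deg hg).
Proof. by rewrite [LHS]flsubst_bracket; apply: eq_flbracket. Qed.

Lemma Io_bracket i j f g (hf : fldeg i f) (hg : fldeg j g) :
  Io (flbracket hf hg) = flbracket (Io_deg hf) (Io_deg hg).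
Proof. by rewrite [LHS]flsubst_bracket; apply: eq_flbracket. Qed.

(** A form on [H] is lifted by the section [Io] of [Pi]. No compatibility of [Io] with [der'] is
    claimed, so the vanishing of the square has to wait until [Pi] is known to intertwine [der']
    with [mder]. *)
Definition mder : {linear freeLie U -> freeLie U} := Pi \o der' \o Io.

Lemma mderE f : mder f = Pi (der' (Io f)). Proof. by []. Qed.

Lemma mder_deg i f : fldeg i f -> fldeg (i + 1) (mder f).
Proof. by move=> hf; apply/Pi_deg/der'_deg/Io_deg. Qed.

Lemma mder_der i j f g (hf : fldeg i f) (hg : fldeg j g) :
  mder (flbracket hf hg) =
    flbracket (mder_deg hf) hg + ksign K i *: flbracket hf (mder_deg hg).
Proof.
rewrite mderE Io_bracket der'_der linearD linearZ /= !Pi_bracket.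
by congr (_ + _ *: _); apply: eq_flbracket => //; apply: PiIo.
Qed.

Lemma mder_cont : fl_continuous mder.
Proof.
apply: fl_cont_comp; first exact: flsubst_cont.
by apply: fl_cont_comp; [apply: der'_cont|apply: flsubst_cont].
Qed.

(** Transposing [id = hproj + d h + h d] splits [x] as [Io (Pi x) + a + der' c], with [a] and [c]
    both fixed by composition with [d h]. The last term is killed since [der'] squares to zero, and
    [der' a = a d] vanishes on [H], where [d] is zero. *)
Lemma Pi_der'_gen i (x : freeLie P) : multilinear (flval x) ->
  tensor_degree 1 (flval x) -> form_deg i (flval x) ->
  Pi (der' x) = Pi (der' (Io (Pi x))).
Proof.
move=> mx tx dx.
have dhg : lie_monomial (i + 0) (lform (d \o h) (flval x)).
  by apply: lform_gen => // j v; rewrite addr0; apply: dhdeg.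
have hg : lie_monomial (i - 1) (lform h (flval x)) by apply: lform_gen.
pose a := mkfl (mono_fldeg dhg); pose c := mkfl (mono_fldeg hg).
have ea : flval (der' a) = lform d (flval a).
  by apply: (@der'_lform _ a dhg) => [|v] /=; [apply: lform_tensor|rewrite hdh].
have ec : flval (der' c) = lform d (flval c).
  by apply: (@der'_lform _ c hg) => [|v] /=; [apply: lform_tensor|rewrite hdh].
have ex : x = Io (Pi x) + a + der' c.
  apply: fl_eq => w; rewrite !flvalD IoE PiE ec -map_comp.
  have [w1|w1] := eqVneq (size w) 1%N; last first.
    have -> : flval a w = 0 by apply: lform_tensor.
    have -> : lform d (flval c) w = 0 by apply: lform_tensor.
    by rewrite !tx ?size_map // !addr0.
  case: w w1 => [|v [|v' w]] w1; [by []| |by []].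
  have -> : flval x (map (incl \o proj) [:: v]) = flval x [:: hproj v] by [].
  have -> : flval a [:: v] = flval x [:: d (h v)] by [].
  have -> : lform d (flval c) [:: v] = flval x [:: h (d v)] by [].
  rewrite hprojE !multilinear1B //.
  by rewrite addrAC subrK subrK.
have a0 : Pi (der' a) = 0.
  apply: fl_eq => w; rewrite PiE ea.
  case: w => [|u [|? ?]] //=; rewrite dhd.
  rewrite -[incl u]hproj_incl.
  by rewrite d_hproj multilinear1_0.
by rewrite {1}ex !linearD a0 der'_sq linear0 !addr0.
Qed.

(** Both sides are derivations along the homomorphism [Pi], so agreement on generators is enough. *)
Lemma Pi_der' f : Pi (der' f) = mder (Pi f).
Proof.
apply/eqP; rewrite -subr_eq0; apply/eqP.
pose E : {linear freeLie P -> freeLie U} := (Pi \o der') \- (mder \o Pi).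
have EE g : E g = Pi (der' g) - mder (Pi g) by [].
rewrite -EE; apply: fl_lie_ext.
- apply: fl_contB; apply: fl_cont_comp; try exact: flsubst_cont.
    exact: der'_cont.
  exact: mder_cont.
- by move=> i x mx tx dx; rewrite EE (Pi_der'_gen mx tx dx) subrr.
- move=> i j x y hx hy /eqP; rewrite EE subr_eq0 => /eqP ex /eqP.
  rewrite EE subr_eq0 => /eqP ey; apply/eqP; rewrite EE subr_eq0; apply/eqP.
  rewrite [in RHS]Pi_bracket mder_der der'_der linearD linearZ /= !Pi_bracket.
  by congr (_ + _ *: _); apply: eq_flbracket.
Qed.

Lemma mder_sq f : mder (mder f) = 0.
Proof. by rewrite [mder f]mderE -Pi_der' der'_sq linear0. Qed.

(** As [psi] preserves linear parts, the value is that of a linear form at [d] of an element of [H],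
    which is zero. *)
Lemma mder_lin f u : flval (mder f) [:: u] = 0.
Proof.
rewrite mderE PiE [map _ _]/= der'E psi_lin der_linear_part.
rewrite -[incl u]hproj_incl.
by rewrite d_hproj multilinear1_0 //; apply: fl_multilinear.
Qed.

Definition mstructure : cinf_structure coh :=
  CInfStructure mder_cont mder_der mder_sq.

Definition quot : {linear freeLie P -> freeLie U} := Pi \o psi.

Lemma quotE f : quot f = Pi (psi f). Proof. by []. Qed.

Lemma quot_cont : fl_continuous quot.
Proof. by apply: fl_cont_comp; [apply: flsol_cont|apply: flsubst_cont]. Qed.

Lemma quot_deg i f : fldeg i f -> fldeg i (quot f).
Proof. by move=> hf; apply/Pi_deg/psi_deg. Qed.

Lemma quot_bracket i j f g (hf : fldeg i f) (hg : fldeg j g) :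
  quot (flbracket hf hg) = flbracket (quot_deg hf) (quot_deg hg).
Proof. by rewrite quotE psi_bracket Pi_bracket; apply: eq_flbracket. Qed.

Lemma quot_comm f : quot (m f) = mder (quot f).
Proof. by rewrite !quotE -Pi_der' der'E PsiK. Qed.

Lemma quot_lin f u : flval (quot f) [:: u] = flval f [:: incl u].
Proof. by rewrite quotE PiE; apply: psi_lin. Qed.

(** A cycle [v] equals [hproj v + d (h v)], so it is homologous to an element of [H]; a boundary
    lying in [H] is fixed by [hproj] and also killed by it, so it is zero. *)
Lemma incl_quasi_iso :
  quasi_iso (U := coh) (V := V) (\0 : {linear coh -> coh}) (d : {linear P -> P}) incl.
Proof.
split.
- move=> u; transitivity (0 : V); first exact: (linear0 incl).
  by have := d_hproj (incl u); rewrite hproj_incl.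
- move=> u _ [v hv]; exists 0; apply: val_inj => /=.
  by rewrite -fixvalE [fixval u]hv [LHS]hproj_d.
- move=> v dv; exists (proj v); split=> //; exists (h v).
  by rewrite [X in X + _]incl_proj hprojE dv linear0 subr0 subrK.
Qed.

End Minimal.

Theorem corollary5p6 (K : gradedField) (V : cinf_algebra K) :
  exists U : cinf_algebra K, cinf_minimal U /\
    exists phi : cinf_morphism U V, weak_equivalence phi.
Proof.
pose d : {linear susp V -> susp V} := lin_dual (ci_cont (ca_diff V)).
have [h [hdeg dhd hdh hh]] := hodge (der_lin_sq (ca_diff V)) (der_lin_deg (ca_diff V)).
pose U := CInfAlgebra (gmod_gfree (coh hdeg dhd hdh hh)) (mstructure hdeg dhd hdh hh).
have minU : linear_part_dual (ca_diff U) (\0 : {linear U -> U}).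
  move=> f tf u; rewrite [LHS]mder_lin.
  by rewrite [RHS]multilinear1_0 //; apply: fl_multilinear.
exists U; split; first by exists (\0 : {linear U -> U}); split.
pose phi := @CInfMorphism K U V (quot hdeg dhd hdh hh) (@quot_cont _ _ _ _ hdeg dhd hdh hh)
  (@quot_deg _ _ _ _ hdeg dhd hdh hh) (@quot_bracket _ _ _ _ hdeg dhd hdh hh)
  (quot_comm hdeg dhd hdh hh).
exists phi, (\0 : {linear U -> U}), d.
exists (incl hdeg dhd hdh hh); split=> //.
- by move=> f tf v; apply: der_linear_part.
- by move=> f tf u; apply: quot_lin.
- exact: incl_quasi_iso.
Qed.
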